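(* Let $t,u,v\in\mathrm{ACol}(C_n)$ and $w=tuv$, and let $w^0$ be the highest weight word of the connected component of $w$ in the crystal graph on $\mathrm{ACol}(C_n)^*$. Then $\mathrm{conf}(w)=\mathrm{conf}(w^0)$.
   Context: Setting: $C_n=\{1<\cdots<n<\overline n<\cdots<\overline1\}$ with its type $C$ crystal graph; Kashiwara operators act on $C_n^*$ by the tensor product rule. Columns, admissible columns, $\preceq$, tableau words, $Pl(C_n)$ and column insertion are the standard type $C$ notions (Lecouvey). $\mathrm{ACol}(C_n)$ is the set of admissible columns together with an extra symbol $\epsilon$; $p:\mathrm{ACol}(C_n)^*\to C_n^*$ sends $\epsilon$ to the empty word and each admissible column to itself. $\preceq$ is extended by $c\preceq\epsilon$ for all $c$ and $\epsilon\not\preceq c$ for $c\ne\epsilon$; $(c_1\leftarrow c_2)\in\mathrm{ACol}(C_n)^2$ is $d_1d_2$, $\epsilon d$, or $\epsilon\epsilon$ according as the tableau word of $p(c_1)p(c_2)$ is $d_1d_2$, one column $d$, or empty. $\mathbf{ACol}$ is the (convergent) 2-polygraph with generators $\mathrm{ACol}(C_n)$ and rules $c_1c_2\Rightarrow(c_1\leftarrow c_2)$ for $c_2\not\preceq c_1$. Crystal structure on $\mathrm{ACol}(C_n)^*$: $f_iw$ (resp. $e_iw$) is defined iff $f_ip(w)$ (resp. $e_ip(w)$) is defined, and then is obtained by replacing the column of $w$ containing the modified letter by the modified column; $w$ is of highest weight if no $e_i$ is defined on it. For a word $w$ of three letters of $\mathrm{ACol}(C_n)$, let $a(w)$ be the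 longest sequence of rewriting steps starting from $w$ that alternately rewrites the pair in positions $(1,2)$, then $(2,3)$, then $(1,2)$, etc., starting with positions $(1,2)$ (the leftmost reduction strategy), and $b(w)$ the analogous longest alternating sequence starting with positions $(2,3)$ (the rightmost reduction strategy). Both are finite and end at the normal form of $w$. The confluence pair is $\mathrm{conf}(w)=(|a(w)|,|b(w)|)$, the numbers of rewriting steps. *)

(* Defs.v *)
From Stdlib Require Import Relations ClassicalEpsilon.
From mathcomp Require Import all_boot ssralg ssrint.

Set Implicit Arguments.
Unset Strict Implicit.
Unset Printing Implicit Defensive.

(* The alphabet C_n = {1 < ... < n < nbar < ... < 1bar} is encoded by the   *)
(* naturals 0 .. 2n-1 with the natural order: x < n encodes the unbarred     *)
(* letter x+1, and x >= n encodes the barred letter bar(2n - x).            *)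

Definition bar (n x : nat) : nat := (2 * n).-1 - x.

(* Kashiwara operators on the crystal C_n, index i = j+1 with j < n:
   f_i : i -> i+1 and (i+1)bar -> ibar (i < n), f_n : n -> nbar.
   In the encoding: f_{j+1} x = x+1 for x = j or x = 2n-2-j.
   sgnL returns Some true when f is defined on x ('+'), Some false when e is
   defined on x ('-'), None otherwise.  (each letter carries at most one sign) *)
Definition sgnL (n j x : nat) : option bool :=
  if (x == j) || (x == 2 * n - 2 - j) then Some true
  else if (x == j.+1) || (x == 2 * n - 1 - j) then Some false
  else None.

(* Tensor product rule: cancel successively the factors "+-" (a '+' to the
   left of a '-'); the reduced signature is -...-+...+ ; f acts on the letter
   of the leftmost remaining '+', e on the letter of the rightmost remaining '-'.
   unm returns (P, M): positions of unmatched '+' (most recent first) and of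
   unmatched '-' (most recent first). *)
Fixpoint unm (s : seq (option bool)) (k : nat) (P M : seq nat)
  : seq nat * seq nat :=
  match s with
  | [::] => (P, M)
  | Some true :: s' => unm s' k.+1 (k :: P) M
  | Some false :: s' =>
      if P is _ :: P' then unm s' k.+1 P' M else unm s' k.+1 P (k :: M)
  | None :: s' => unm s' k.+1 P M
  end.

Definition fL (n j : nat) (w : seq nat) : option (seq nat) :=
  match (unm [seq sgnL n j x | x <- w] 0 [::] [::]).1 with
  | [::] => None
  | k0 :: P' => let k := last k0 P' in Some (set_nth 0 w k (nth 0 w k).+1)
  end.

Definition eL (n j : nat) (w : seq nat) : option (seq nat) :=
  match (unm [seq sgnL n j x | x <- w] 0 [::] [::]).2 with
  | [::] => None
  | k :: _ => Some (set_nth 0 w k (nth 0 w k).-1)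
  end.

Definition wtL (n : nat) (w : seq nat) : seq int :=
  [seq ((count_mem z w)%:Z - (count_mem (bar n z) w)%:Z)%R | z <- iota 0 n].

Definition connL (n : nat) : relation (seq nat) :=
  clos_refl_sym_trans _ (fun x y => exists2 j, j < n & fL n j x = Some y).

(* plactic congruence of type C_n (crystal monoid): u and v occupy the same
   position in isomorphic connected components, i.e. there is a crystal
   isomorphism (weight preserving, commuting with all e_i and f_i, bijective)
   from the component of u onto the component of v sending u to v. *)
Definition plac (n : nat) (u v : seq nat) : Prop :=
  exists phi : seq nat -> seq nat,
    [/\ phi u = v,
        forall x, connL n u x ->
          wtL n (phi x) = wtL n x /\
          (forall j, j < n ->
             fL n j (phi x) = omap phi (fL n j x) /\
             eL n j (phi x) = omap phi (eL n j x)),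
        forall x y, connL n u x -> connL n u y -> phi x = phi y -> x = y
      & forall y, connL n v y -> exists2 x, connL n u x & phi x = y].

Definition is_col (n : nat) (c : seq nat) : bool :=
  [&& c != [::], sorted ltn c & all (fun x => x < 2 * n) c].

Definition zs_of (n : nat) (c : seq nat) : seq nat :=
  rev [seq z <- iota 0 n | (z \in c) && (bar n z \in c)].

Fixpoint ts_of (n : nat) (c : seq nat) (zs : seq nat) (prev : nat)
  : option (seq nat) :=
  match zs with
  | [::] => Some [::]
  | z :: zs' =>
      match [seq t <- iota 0 (minn prev z) | (t \notin c) && (bar n t \notin c)] with
      | [::] => None
      | t0 :: cs => let t := last t0 cs in omap (cons t) (ts_of n c zs' t)
      end
  end.

Definition admissible (n : nat) (c : seq nat) : bool :=
  is_col n c && isSome (ts_of n c (zs_of n c) n).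

Definition ts (n : nat) (c : seq nat) : seq nat :=
  odflt [::] (ts_of n c (zs_of n c) n).

Definition lcol (n : nat) (c : seq nat) : seq nat :=
  [seq x <- iota 0 (2 * n) |
     ((x \in c) && (x \notin zs_of n c)) || (x \in ts n c)].

Definition rcol (n : nat) (c : seq nat) : seq nat :=
  [seq x <- iota 0 (2 * n) |
     ((x \in c) && (x \notin map (bar n) (zs_of n c)))
     || (x \in map (bar n) (ts n c))].

(* c <= d : the two-column array with c on the left and d on the right is a
   type C tableau, i.e. its split form lc rc ld rd is a semistandard tableau:
   |c| >= |d| and rc <= ld rowwise. *)
Definition colle (n : nat) (c d : seq nat) : bool :=
  (size d <= size c) &&
  all (fun k => nth 0 (rcol n c) k <= nth 0 (lcol n d) k) (iota 0 (size d)).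

(* ACol(C_n) : admissible columns plus epsilon (= None).                    *)

Definition acol := option (seq nat).

Definition isACol (n : nat) (a : acol) : bool :=
  if a is Some c then admissible n c else true.

Definition aprec (n : nat) (a b : acol) : bool :=
  match a, b with
  | _, None => true
  | None, Some _ => false
  | Some c, Some d => colle n c d
  end.

Definition pw (w : seq acol) : seq nat := flatten [seq odflt [::] a | a <- w].

(* (c1 <- c2) = x y where x y is the tableau word (padded on the left by eps)
   plactic-congruent to p(c1)p(c2): x, y in ACol, y <= x. *)
Definition ins_spec (n : nat) (c1 c2 : acol) (xy : acol * acol) : Prop :=
  [/\ isACol n xy.1, isACol n xy.2, aprec n xy.2 xy.1
    & plac n (pw [:: xy.1; xy.2]) (pw [:: c1; c2])].

Definition ins (n : nat) (c1 c2 : acol) : acol * acol :=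
  epsilon (inhabits (c1, c2)) (ins_spec n c1 c2).

(* one rewriting step of the 2-polygraph ACol at positions (1,2) (p = 0) or
   (2,3) (p = 1): c1 c2 => (c1 <- c2) when c2 </= c1. *)
Definition step_at (n p : nat) (w : seq acol) : option (seq acol) :=
  match p, w with
  | 0, a :: b :: r =>
      if aprec n b a then None else Some ((ins n a b).1 :: (ins n a b).2 :: r)
  | 1, a :: b :: c :: r =>
      if aprec n c b then None
      else Some (a :: (ins n b c).1 :: (ins n b c).2 :: r)
  | _, _ => None
  end.

(* altlen n p w k : the longest sequence of rewriting steps from w alternating
   between positions (1,2) and (2,3), starting at position p (0 = (1,2),
   1 = (2,3)), has exactly k steps. *)
Inductive altlen (n : nat) : nat -> seq acol -> nat -> Prop :=
| alt_stop p w : step_at n p w = None -> altlen n p w 0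
| alt_step p w w' k :
    step_at n p w = Some w' -> altlen n (1 - p) w' k -> altlen n p w k.+1.

Definition conf_is (n : nat) (w : seq acol) (ka kb : nat) : Prop :=
  altlen n 0 w ka /\ altlen n 1 w kb.

Definition regroup (w : seq acol) (s : seq nat) : seq acol :=
  [seq (if a.1 is Some _ then Some a.2 else None)
  | a <- zip w (reshape [seq size (odflt [::] a) | a <- w] s)].

Definition fA (n j : nat) (w : seq acol) : option (seq acol) :=
  omap (regroup w) (fL n j (pw w)).

Definition eA (n j : nat) (w : seq acol) : option (seq acol) :=
  omap (regroup w) (eL n j (pw w)).

Definition connA (n : nat) : relation (seq acol) :=
  clos_refl_sym_trans _ (fun x y => exists2 j, j < n & fA n j x = Some y).

Definition highestA (n : nat) (w : seq acol) : Prop :=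
  forall j, j < n -> eA n j w = None.

(* Main.v *)
(** Write C for the type C crystal. A rewriting step replaces two columns by
    the two-column tableau that is plactic-equivalent to them, so it suffices to
    show that the relation c <= d and the insertion (c1 <- c2) commute with the
    Kashiwara operators; then reductions of w and of f_j w run in parallel and
    have the same lengths along the whole component.

    - Counting letters turns admissibility and the relation <= into linear
      inequalities between the counting functions of the columns. An operator
      f_j moves these functions only at j+1 and its bar, and the inequalities
      survive by comparison with the neighbouring indices.

    - Highest weight words of equal weight have isomorphic components. Send a
      letter x to the pair of subsets ({x}, everything but bar x): this embeds
      words over C_n into 0/1 matrices with 2n columns carrying the type A
      crystal, f_j becoming f_j f_(2n-j). On 0/1 matrices the analogous
      operators moving entries between consecutive rows commute with the
      crystal, and applying them as long as possible to a highest weight matrix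
      yields a staircase that depends only on the column sums. The composite of
      such operators is the required isomorphism.

    - Hence every product of two columns has a tableau in its plactic class
      (the weight of a highest weight product has parts 0, 1, 2), and it is
      unique because highest weight tableaux are determined by their weight. *)

Require Import Defs.
From Stdlib Require Import Relations ClassicalEpsilon.
From mathcomp Require Import all_boot order ssralg ssrint ssrnum zify.

Set Implicit Arguments.
Unset Strict Implicit.
Unset Printing Implicit Defensive.

(** * Crystal operators on words over a signed alphabet *)

(** [plac] speaks of isomorphic crystal components and [ins] is a bare choice for its specification,
    so there is no insertion algorithm to follow. That the choice meets the specification needs an
    explicit isomorphism of components; that it commutes with f_j needs uniqueness of the tableau.
    Both questions are moved to highest weight words by applying e_j, which lowers the sum of the
    letters.

    The obstacle to writing the isomorphism down in type C is that plactic equivalent words may have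
    different lengths. The embedding is the folding of type A_(2n-1), and 0/1 matrices carry a
    second crystal structure commuting with the first, the combinatorial form of skew Howe duality;
    its operators link the two images once their column sums agree.

    In a word of three columns the tensor product rule chooses the factor on which f_j acts by
    comparing the numbers epsilon and phi of the factors. These are plactic invariants, so rewriting
    a pair does not alter the choice; this is why f_j passes through a rewriting step of a longer
    word. *)

Section WordCrystal.
Variables (L : Type) (sg : L -> option bool) (dn up : L -> L).
Implicit Types (u v w : seq L).

(* Numbers of unmatched - and + of the signature. Reading a word from its right
   end, a + is unmatched iff the rest has no unmatched -. *)
Fixpoint ep w : nat :=
  if w is x :: w' then
    match sg x with
    | Some true => (ep w').-1
    | Some false => (ep w').+1
    | None => ep w'
    end
  else 0.

Fixpoint ph w : nat :=
  if w is x :: w' then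
    if (sg x == Some true) && (ep w' == 0) then (ph w').+1 else ph w'
  else 0.

Fixpoint fG w : option (seq L) :=
  if w is x :: w' then
    if (sg x == Some true) && (ep w' == 0) then Some (dn x :: w')
    else omap (cons x) (fG w')
  else None.

Fixpoint eG w : option (seq L) :=
  if w is x :: w' then
    match sg x with
    | Some true => if 1 < ep w' then omap (cons x) (eG w') else None
    | Some false =>
        if 0 < ep w' then omap (cons x) (eG w') else Some (up x :: w')
    | None => omap (cons x) (eG w')
    end
  else None.

Lemma ep_cat u v : ep (u ++ v) = ep u + (ep v - ph u).
Proof.
elim: u => [|x u IH] /=; first by rewrite subn0.
by case: (sg x) => [[]|] /=; rewrite ?IH //; try case: eqP; lia.
Qed.

Lemma ph_cat u v : ph (u ++ v) = ph v + (ph u - ep v).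
Proof.
elim: u => [|x u IH] /=; first by rewrite sub0n addn0.
by rewrite ep_cat IH; case: (_ == _) => //=; do 2 case: eqP; lia.
Qed.

Lemma fG_None w : fG w = None <-> ph w = 0.
Proof.
elim: w => [|x w IH] //=; case: (_ && _) => //.
by rewrite -IH; case: (fG w).
Qed.

Lemma eG_None w : eG w = None <-> ep w = 0.
Proof.
elim: w => [|x w IH] //=.
have oN : omap (cons x) (eG w) = None <-> ep w = 0 by rewrite -IH; case: (eG w).
case: (sg x) => [[]|] //.
- by case: ltnP => Hw; rewrite ?oN; split => //; lia.
- by case: ltnP => Hw; rewrite ?oN; split => //; lia.
Qed.

Lemma fG_cat u v :
  fG (u ++ v) = if ep v < ph u then omap (cat^~ v) (fG u) else omap (cat u) (fG v).
Proof.
elim: u => [|x u IH] /=; first by case: (fG v).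
have E : omap (cons x) (fG (u ++ v)) = if ep v < ph u
    then omap (cat^~ v) (omap (cons x) (fG u)) else omap (cat (x :: u)) (fG v).
  by rewrite IH; case: ifP => _; [case: (fG u)|case: (fG v)].
rewrite ep_cat E; case: (_ == _) => //=.
case: (eqVneq (ep u) 0) => Hu /=; last by case: eqP => ? //; lia.
case: eqP => Hv /=; first by case: ltnP => //; lia.
by do ?case: ltnP => ? //; lia.
Qed.

Lemma eG_cat u v :
  eG (u ++ v) = if ph u < ep v then omap (cat u) (eG v) else omap (cat^~ v) (eG u).
Proof.
elim: u => [|x u IH] /=.
  case: ltnP => Hv; first by case: (eG v).
  by have /eG_None -> : ep v = 0 by lia.
have E : omap (cons x) (eG (u ++ v)) = if ph u < ep v
    then omap (cat (x :: u)) (eG v) else omap (cat^~ v) (omap (cons x) (eG u)).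
  by rewrite IH; case: ifP => _; [case: (eG v)|case: (eG u)].
rewrite ep_cat E; case: (sg x) => [[]|] //=; last first.
  by case: (eqVneq (ep u) 0) => Hu; do ?case: ltnP => ? //; lia.
case: (eqVneq (ep u) 0) => Hu /=; last by do ?case: ltnP => ? //; lia.
have -> /= : eG u = None by apply/eG_None.
by rewrite Hu add0n; do ?case: ltnP => ? //; lia.
Qed.

Lemma fG_size w w' : fG w = Some w' -> size w' = size w.
Proof.
elim: w w' => [|x w IH] w' //=; case: ifP => _; first by case=> <-.
by case E: (fG w) => [y|] //= [<-] /=; rewrite (IH _ E).
Qed.

End WordCrystal.

(* Positions of the unmatched + and -, rightmost first, as [unm] lists them. *)
Fixpoint plus_pos (s : seq (option bool)) : seq nat :=
  if s is x :: s' then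
    map S (plus_pos s') ++ (if (x == Some true) && (ep id s' == 0) then [:: 0] else [::])
  else [::].

Fixpoint minus_pos (s : seq (option bool)) : seq nat :=
  if s is x :: s' then
    match x with
    | Some true => map S (take (ep id s').-1 (minus_pos s'))
    | Some false => map S (minus_pos s') ++ [:: 0]
    | None => map S (minus_pos s')
    end
  else [::].

Lemma size_minus_pos s : size (minus_pos s) = ep id s.
Proof.
elim: s => [|[[]|] s IH] //=; rewrite ?size_cat ?size_map ?size_take ?IH //=; last by lia.
by case: ltnP; lia.
Qed.

(** The unmatched - of [s] pop [ep id s] entries from the stack [P]. Those absorbed by the stack are
    the leftmost ones, and [minus_pos] lists positions from the right, so the survivors form an
    initial segment of it. *)
Lemma unmE s k P M :
  unm s k P M = (map (addn k) (plus_pos s) ++ drop (ep id s) P,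
                 map (addn k) (take (ep id s - size P) (minus_pos s)) ++ M).
Proof.
have kS h r : [seq h.+1 + i | i <- r] = [seq h + i | i <- map S r].
  by rewrite -map_comp; apply: eq_map => i /=; lia.
elim: s k P M => [|[[]|] s IH] k P M /=.
- by rewrite drop0.
- rewrite IH !kS /= map_cat; congr pair.
    rewrite -catA; congr cat; case: eqP => [->|] /=; first by rewrite addn0 drop0.
    by case: (ep id s).
  congr (map _ _ ++ _); rewrite -map_take take_takel; last by lia.
  by congr (map _ (take _ _)); lia.
- case: P => [|p P]; rewrite IH !kS /= ?cats0 //.
    congr pair; rewrite !subn0 -size_minus_pos take_size take_oversize.
      by rewrite map_cat -catA /= addn0.
    by rewrite size_cat size_map /=; lia.
  congr pair; congr (map _ _ ++ _); rewrite takel_cat ?map_take //.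
  by rewrite size_map size_minus_pos; lia.
- by rewrite IH !kS /= cats0 map_take.
Qed.

Lemma ep_map (L : Type) (sg : L -> option bool) w : ep id (map sg w) = ep sg w.
Proof. by elim: w => //= x w ->. Qed.

Lemma fG_plus_pos (L : Type) (x0 : L) sg (dn : L -> L) w :
  fG sg dn w =
  if plus_pos (map sg w) is k0 :: P then
    let k := last k0 P in Some (set_nth x0 w k (dn (nth x0 w k)))
  else None.
Proof.
elim: w => [|x w IH] //=; rewrite ep_map IH.
case: (_ && _) => /=.
  by case: (plus_pos _) => [|k0 P] //=; rewrite last_cat.
rewrite cats0; case: (plus_pos _) => [|k0 P] //=; congr Some.
by rewrite last_map.
Qed.

Lemma eG_minus_pos (L : Type) (x0 : L) sg (up : L -> L) w :
  eG sg up w =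
  if minus_pos (map sg w) is k :: _ then Some (set_nth x0 w k (up (nth x0 w k))) else None.
Proof.
elim: w => [|x w IH] //=; rewrite -(ep_map sg) -size_minus_pos IH.
case: (sg x) => [[]|] /=.
- by case: (minus_pos _) => [|k0 [|k1 M]].
- by case: (minus_pos _) => [|k0 P].
- by case: (minus_pos _) => [|k0 P].
Qed.

Lemma fLE n j w : fL n j w = fG (sgnL n j) succn w.
Proof.
rewrite /fL unmE (fG_plus_pos 0) /= cats0.
by rewrite map_id.
Qed.

Lemma eLE n j w : eL n j w = eG (sgnL n j) predn w.
Proof.
rewrite /eL unmE cats0 (eG_minus_pos 0) /= subn0 -size_minus_pos take_size.
by rewrite map_id.
Qed.

Section WordCrystalInverse.
Variables (L : Type) (sg : L -> option bool) (dn up : L -> L).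
Hypothesis dnP : forall x, sg x = Some true -> sg (dn x) = Some false /\ up (dn x) = x.
Hypothesis upP : forall x, sg x = Some false -> sg (up x) = Some true /\ dn (up x) = x.
Implicit Types (u v w : seq L).
Local Notation ep := (ep sg).
Local Notation ph := (ph sg).
Local Notation fG := (fG sg dn).
Local Notation eG := (eG sg up).

Lemma fG_ep w w' : fG w = Some w' -> ep w' = (ep w).+1.
Proof.
elim: w w' => [|x w IH] w' //=; case: ifP => [/andP[/eqP Ex /eqP Ew]|].
  by case=> <- /=; rewrite Ex (dnP Ex).1 Ew.
case E: (fG w) => [y|] // Hx [<-] /=; rewrite (IH _ E).
by case: (sg x) Hx => [[]|] //= /eqP; lia.
Qed.

Lemma fG_eG w w' : fG w = Some w' -> eG w' = Some w.
Proof.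
elim: w w' => [|x w IH] w' //=; case: ifP => [/andP[/eqP Ex /eqP Ew]|].
  by case=> <- /=; rewrite Ew (dnP Ex).1 (dnP Ex).2.
case E: (fG w) => [y|] // Hx [<-] /=; rewrite (IH _ E) (fG_ep E).
by case: (sg x) Hx => [[]|] //= /eqP; case: ltnP => //; lia.
Qed.

Lemma eG_fG w w' : eG w = Some w' -> fG w' = Some w.
Proof.
elim: w w' => [|x w IH] w' //=.
have H y : omap (cons x) (eG w) = Some y ->
    (if sg x is Some true then 1 < ep w else true) -> fG y = Some (x :: w).
  case E: (eG w) => [z|] // [<-] /= Hx; rewrite (IH _ E) (fG_ep (IH _ E)) in Hx *.
  by case: (sg x) Hx => [[]|] //=; case: (ep z).
case Ex: (sg x) H => [[]|] H.
- by case: ifP => // Hw /H; apply.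
- case: ltnP => [Hw /H|]; first by apply.
  by move=> Hw [<-] /=; rewrite (upP Ex).1 (upP Ex).2; case: (ep w) Hw.
- by move=> /H; apply.
Qed.

Lemma fG_ph w w' : fG w = Some w' -> ph w = (ph w').+1.
Proof.
elim: w w' => [|x w IH] w' //=; case: ifP => [/andP[/eqP Ex /eqP Ew]|].
  by case=> <- /=; rewrite (dnP Ex).1 /=.
case E: (fG w) => [y|] // Hx [<-] /=; rewrite (IH _ E) (fG_ep E).
by rewrite andbF.
Qed.

End WordCrystalInverse.

(** In a word without unmatched -, every - is cancelled by some + on its left. This is the form in
    which the highest weight condition is used, both for rows of matrices and for letters of
    columns. *)
Lemma ep0_prefix (L : Type) (sg : L -> option bool) u x v :
  ep sg (u ++ x :: v) = 0 -> sg x = Some false -> has (fun y => sg y == Some true) u.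
Proof.
rewrite ep_cat /= => + Ex; rewrite Ex => H.
have {H} : 0 < ph sg u by lia.
elim: u => //= y u IH; case: eqP => //= _; exact: IH.
Qed.

Lemma fG_stat (L S : Type) (sg : L -> option bool) dn (g : L -> S) w w' :
  (forall x, sg x = Some true -> g (dn x) = g x) -> fG sg dn w = Some w' -> map g w' = map g w.
Proof.
move=> H; elim: w w' => [|x w IH] w' //=; case: ifP => [/andP[/eqP Ex _]|_].
  by case=> <- /=; rewrite H.
by case E: (fG _ _ w) => [y|] // [<-] /=; rewrite (IH _ E).
Qed.

(** * The type A crystal on 0/1 matrices and its commuting operators *)

(* A 0/1 matrix is a list of rows. As a letter of the type A crystal, a row is the
   set of the positions of its ones, and both f_i and e_i swap the positions i
   and i+1. *)
Fixpoint row_sign (i : nat) (r : seq bool) : option bool :=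
  match i, r with
  | 0, a :: b :: _ => if a == b then None else Some a
  | i'.+1, _ :: r' => row_sign i' r'
  | _, _ => None
  end.

Fixpoint row_swap (i : nat) (r : seq bool) : seq bool :=
  match i, r with
  | 0, a :: b :: s => b :: a :: s
  | i'.+1, a :: r' => a :: row_swap i' r'
  | _, _ => r
  end.

Lemma size_row_swap i r : size (row_swap i r) = size r.
Proof. by elim: i r => [|i IH] [|a [|b r]] //=; rewrite IH. Qed.

Lemma row_swapK i r : row_swap i (row_swap i r) = r.
Proof. by elim: i r => [|i IH] [|a [|b r]] //=; rewrite IH. Qed.

Lemma row_sign_row_swap i r : row_sign i (row_swap i r) = omap negb (row_sign i r).
Proof. by elim: i r => [|i IH] [|a [|b r]] //=; case: a b => [] []. Qed.

Lemma row_signE i r : row_sign i r =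
  if (i.+1 < size r) && (nth false r i != nth false r i.+1) then Some (nth false r i) else None.
Proof.
by elim: i r => [|i IH] [|a [|b r]] //=; case: eqP.
Qed.

Definition mat_f i := fG (row_sign i) (row_swap i).
Definition mat_e i := eG (row_sign i) (row_swap i).

Arguments mat_f : simpl never.
Arguments mat_e : simpl never.

Lemma mat_f_mat_e i M N : mat_f i M = Some N <-> mat_e i N = Some M.
Proof.
have H b r : row_sign i r = Some b -> row_sign i (row_swap i r) = Some (~~ b) /\ row_swap i (row_swap i r) = r.
  by move=> E; rewrite row_sign_row_swap E row_swapK.
by split=> E; [apply: fG_eG E => r|apply: eG_fG E => r] => /H.
Qed.

Lemma mat_f_None i M : mat_f i M = None <-> ph (row_sign i) M = 0.
Proof. exact: fG_None. Qed.

Lemma mat_e_None i M : mat_e i M = None <-> ep (row_sign i) M = 0.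
Proof. exact: eG_None. Qed.

(* Two rows read as a list of columns. The column (0, 1) counts as + and the
   operator [dual_pair] moves a one from the lower to the upper row. *)
Definition col_sign (p : bool * bool) : option bool := if p.1 == p.2 then None else Some p.2.
Definition col_swap (p : bool * bool) := (p.2, p.1).

Definition dual_pair := fG col_sign col_swap.

Definition rows (Z : seq (bool * bool)) := [:: unzip1 Z; unzip2 Z].

(** In a two-row matrix [mat_f i] only touches the columns i and i+1. Isolating this 2 by 2 block
    lets both crystal structures be followed on the same list of columns. *)
Definition block_f (x y : bool * bool) : option ((bool * bool) * (bool * bool)) :=
  if mat_f 0 (rows [:: x; y]) is Some [:: [:: a; b]; [:: c; d]] then Some ((a, c), (b, d)) else None.

Fixpoint pair_f (i : nat) (Z : seq (bool * bool)) : option (seq (bool * bool)) :=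
  match i, Z with
  | 0, x :: y :: Y => omap (fun q => q.1 :: q.2 :: Y) (block_f x y)
  | i'.+1, x :: Z' => omap (cons x) (pair_f i' Z')
  | _, _ => None
  end.

Lemma mat_f_rows i Z : mat_f i (rows Z) = omap rows (pair_f i Z).
Proof.
elim: i Z => [|i IH] [|[a b] Z] //=; first by case: Z => [|[c d] Z] //; move: a b c d => [] [] [] [].
have := IH Z; rewrite /mat_f /=; case: (row_sign i _) => [[]|]; case: (row_sign i _) => [[]|] //=;
  by case: (pair_f i Z) => [W|] //= [-> ->].
Qed.

Lemma pair_f_stat i Z W : pair_f i Z = Some W -> ep col_sign W = ep col_sign Z /\ ph col_sign W = ph col_sign Z.
Proof.
elim: i Z W => [|i IH] [|x Z] W //=.
  case: Z => [|y Z] //; case: x y => [[] []] [[] []] //= [<-] //=; by case: (ep col_sign Z) => [|[|?]].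
by case E: (pair_f i Z) => [Y|] // [<-] /=; have [-> ->] := IH _ _ E.
Qed.

(** On the block of columns i and i+1 this is a finite check, in which the columns further right
    enter only through having 0, 1 or more unmatched -. On columns left of the block, [pair_f_stat]
    guarantees that [dual_pair] makes the same choice before and after. *)
Lemma dual_pair_pair_f i Z : obind (pair_f i) (dual_pair Z) = obind dual_pair (pair_f i Z).
Proof.
rewrite /dual_pair; elim: i Z => [|i IH] [|x Z] //=.
  case: Z => [|y Z] /=; first by case: ifP.
  case: x y => [[] []] [[] []] //=; case: (ep col_sign Z) => [|[|?]] //=;
    by case: (fG col_sign col_swap Z).
case: ifP => Hx /=; last first.
  have -> : obind (pair_f i.+1) (omap (cons x) (fG col_sign col_swap Z)) = omap (cons x) (obind (pair_f i) (fG col_sign col_swap Z)).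
    by case: (fG col_sign col_swap Z).
  rewrite IH; case E: (pair_f i Z) => [Y|] //=.
  by rewrite (pair_f_stat E).1 Hx.
case E: (pair_f i Z) => [Y|] //=.
by rewrite (pair_f_stat E).1 Hx.
Qed.

Lemma dual_pair_stat i Z W : dual_pair Z = Some W ->
  ep (row_sign i) (rows W) = ep (row_sign i) (rows Z) /\ ph (row_sign i) (rows W) = ph (row_sign i) (rows Z).
Proof.
rewrite /dual_pair; elim: i Z W => [|i IH] [|x Z] W //=.
  case: Z => [|y Z]; first by move: x => [[] []] //= [<-].
  move: x y => [[] []] [[] []] //=; case: (ep col_sign Z) => [|[|?]] //=; 
    by try (case: (fG col_sign col_swap Z) => [?|] //=); case=> <-.
case: ifP => Hx; first by case=> <-.
by case E: (fG _ _ Z) => [Y|] // [<-] /=; apply: IH.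
Qed.

Lemma dual_pair_size Z W : dual_pair Z = Some W -> size W = size Z.
Proof. exact: fG_size. Qed.

Lemma dual_pair_inj Z Z' W : dual_pair Z = Some W -> dual_pair Z' = Some W -> Z = Z'.
Proof.
have H x b : col_sign x = Some b -> col_sign (col_swap x) = Some (~~ b) /\ col_swap (col_swap x) = x.
  by case: x => [[] []] // [<-].
move=> /(@fG_eG _ _ _ col_swap) E /(@fG_eG _ _ _ col_swap) E'.
by have [] : Some Z = Some Z' by rewrite -E ?E' // => x /H.
Qed.

Lemma dual_pair_count Z W : dual_pair Z = Some W ->
  (forall p, nth false (unzip1 W) p + nth false (unzip2 W) p =
             nth false (unzip1 Z) p + nth false (unzip2 Z) p) /\
  (count id (unzip1 W) = (count id (unzip1 Z)).+1 /\
   count id (unzip2 Z) = (count id (unzip2 W)).+1).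
Proof.
rewrite /dual_pair; elim: Z W => [|x Z IH] W //=; case: ifP => [/andP[/eqP Ex _]|_].
  by case=> <-; move: x Ex => [[] []] //= _; do !split => //; case.
case E: (fG _ _ Z) => [Y|] // [<-] /=; have [H1 [H2 H3]] := IH _ E.
by rewrite H2 H3; do !split; [case|lia|lia].
Qed.

(** The operator of the second crystal structure, acting on the rows j and j+1. The guard on sizes
    is there because [zip] would truncate the longer row. *)
Fixpoint dual_op (j : nat) (M : seq (seq bool)) : option (seq (seq bool)) :=
  match j, M with
  | 0, r :: s :: B =>
      if size r == size s then omap (fun Z => rows Z ++ B) (dual_pair (zip r s)) else None
  | j'.+1, r :: M' => omap (cons r) (dual_op j' M')
  | _, _ => None
  end.

Lemma rows_zip (r s : seq bool) : size r = size s -> rows (zip r s) = [:: r; s].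
Proof. by move=> E; rewrite /rows unzip1_zip ?unzip2_zip ?E. Qed.

Lemma zip_rows (Z : seq (bool * bool)) : zip (unzip1 Z) (unzip2 Z) = Z.
Proof. exact: zip_unzip. Qed.

Lemma dual_op_stat i j M N : dual_op j M = Some N ->
  ep (row_sign i) N = ep (row_sign i) M /\ ph (row_sign i) N = ph (row_sign i) M.
Proof.
elim: j M N => [|j IH] [|r M] N //; last first.
  by rewrite /=; case E: (dual_op j M) => [Y|] // [<-] /=; have [-> ->] := IH _ _ E.
case: M => [|s B] //; rewrite [dual_op _ _]/=; case: eqP => // Es.
case E: (dual_pair _) => [W|] // [<-].
have [E1 E2] := dual_pair_stat i E; rewrite rows_zip // in E1 E2.
by rewrite -[[:: r, s & B]]/([:: r; s] ++ B) -[[:: unzip1 W, unzip2 W & B]]/(rows W ++ B)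
  !ep_cat !ph_cat E1 E2.
Qed.

(** For the rows 0 and 1 the tensor product rule splits off the remaining rows [B]; by
    [dual_pair_stat] the comparison between the two rows and [B] has the same outcome before and
    after, which leaves the two-row case. *)
Lemma dual_op_mat_f i j M : obind (mat_f i) (dual_op j M) = obind (dual_op j) (mat_f i M).
Proof.
elim: j M => [|j IH] [|r M] //=; last first.
  rewrite {2}/mat_f /= -/(mat_f i); case: ifP => Hr.
    by move=> /=; case E: (dual_op j M) => [Y|] //=; rewrite /mat_f /= (dual_op_stat i E).1 Hr.
  have -> : obind (dual_op j.+1) (omap (cons r) (mat_f i M)) = omap (cons r) (obind (dual_op j) (mat_f i M)).
    by case: (mat_f i M).
  rewrite -IH; case E: (dual_op j M) => [Y|] //=.
  by rewrite /mat_f /= (dual_op_stat i E).1 Hr.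
case: M => [|s B] /=; first by rewrite /mat_f /=; case: ifP.
case: eqP => Es; last first.
  rewrite {2}/mat_f /=; case: ifP => _ /=; first by rewrite size_row_swap; case: eqP.
  case: ifP => _ /=; first by rewrite size_row_swap; case: eqP.
  by case: (fG _ _ B) => [Y|] //=; case: eqP.
have Z2 : mat_f i [:: r; s] = omap rows (pair_f i (zip r s)) by rewrite -mat_f_rows rows_zip.
have S2 : obind (dual_op 0) (omap (cat^~ B) (omap rows (pair_f i (zip r s)))) =
    omap (fun Z => rows Z ++ B) (obind (pair_f i) (dual_pair (zip r s))).
  rewrite dual_pair_pair_f; case: (pair_f i _) => //= W.
  by rewrite !size_map eqxx zip_rows.
rewrite -[[:: r, s & B]]/([:: r; s] ++ B) {2}/mat_f fG_cat -/(mat_f i [:: r; s]) -/(mat_f i B) Z2.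
case E: (dual_pair (zip r s)) => [W|] /=.
  rewrite -[[:: unzip1 W, unzip2 W & B]]/(rows W ++ B) {1}/mat_f fG_cat -/(mat_f i (rows W)) -/(mat_f i B).
  have [_ E2] := dual_pair_stat i E; rewrite rows_zip // in E2; rewrite E2.
  case: ifP => _; last by case: (mat_f i B) => //= C; rewrite Es eqxx E.
  by rewrite S2 E /= mat_f_rows; case: (pair_f i W).
by case: ifP => _; [rewrite S2 E|case: (mat_f i B) => //= C; rewrite Es eqxx E].
Qed.

(** * Crystal isomorphisms of matrices as relations *)

Definition opt_rel (X : Type) (T : X -> X -> Prop) (a b : option X) : Prop :=
  match a, b with
  | Some x, Some y => T x y
  | None, None => True
  | _, _ => False
  end.

Definition colsum (M : seq (seq bool)) (p : nat) : nat := count (fun r => nth false r p) M.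

(** Crystal isomorphisms in relational form. A partial operator such as [dual_op j] qualifies as it
    is, and inverses and composites need no bookkeeping of domains. *)
Definition bisim (T : seq (seq bool) -> seq (seq bool) -> Prop) : Prop :=
  [/\ forall x y y', T x y -> T x y' -> y = y',
      forall x x' y, T x y -> T x' y -> x = x',
      forall x y, T x y -> colsum x =1 colsum y,
      forall i x y, T x y -> opt_rel T (mat_f i x) (mat_f i y)
    & forall i x y, T x y -> opt_rel T (mat_e i x) (mat_e i y)].

Lemma bisim_inv T : bisim T -> bisim (fun x y => T y x).
Proof.
move=> [H1 H2 H3 H4 H5]; split => //.
- by move=> x y y' A B; apply: H2 A B.
- by move=> x y y' A B; apply: H1 A B.
- by move=> x y /H3 E p; rewrite E.
- by move=> i x y /(H4 i); case: (mat_f i x); case: (mat_f i y).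
- by move=> i x y /(H5 i); case: (mat_e i x); case: (mat_e i y).
Qed.

Lemma bisim_comp T U : bisim T -> bisim U -> bisim (fun x z => exists2 y, T x y & U y z).
Proof.
move=> [H1 H2 H3 H4 H5] [K1 K2 K3 K4 K5]; split.
- by move=> x z z' [y Ty Uy] [y' Ty' Uy']; apply: K1 Uy _; rewrite (H1 _ _ _ Ty Ty').
- by move=> x z z' [y Ty Uy] [y' Ty' Uy']; apply: H2 Ty _; rewrite (K2 _ _ _ Uy Uy').
- by move=> x z [y /H3 E /K3 E'] p; rewrite E E'.
- move=> i x z [y /(H4 i) + /(K4 i)]; case: (mat_f i x) => [a|]; case: (mat_f i y) => [b|] //=.
    by case: (mat_f i z) => // c Ta Ub; exists b.
- move=> i x z [y /(H5 i) + /(K5 i)]; case: (mat_e i x) => [a|]; case: (mat_e i y) => [b|] //=.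
    by case: (mat_e i z) => // c Ta Ub; exists b.
Qed.

Lemma bisim_eq : bisim eq.
Proof.
split.
- by move=> x y y' -> ->.
- by move=> x y y' -> ->.
- by move=> x y ->.
- by move=> i x y <-; case: (mat_f i x).
- by move=> i x y <-; case: (mat_e i x).
Qed.

Lemma dual_op_colsum j M N : dual_op j M = Some N -> colsum M =1 colsum N.
Proof.
elim: j M N => [|j IH] [|r M] N //=; last first.
  case E: (dual_op j M) => [Y|] // [<-] p; rewrite /colsum /=.
  by have := IH _ _ E p; rewrite /colsum => ->.
case: M => [|s B] //; case: eqP => // Es; case E: (dual_pair _) => [W|] // [<-] p.
have [H _] := dual_pair_count E; have := H p; rewrite unzip1_zip ?unzip2_zip ?Es //.
by rewrite /colsum /= !addnA => ->.
Qed.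

Lemma dual_op_inj j M M' N : dual_op j M = Some N -> dual_op j M' = Some N -> M = M'.
Proof.
elim: j M M' N => [|j IH] [|r M] [|r' M'] N //=.
  case: M => [|s B] //; case: eqP => // Es; case E: (dual_pair _) => [W|] // [<-].
  case: M' => [|s' B'] //; case: eqP => // Es'; case E': (dual_pair _) => [W'|] // [W1 W2 ->].
  have WW : W' = W by rewrite -(zip_unzip W) -W1 -W2 zip_unzip.
  rewrite WW in E'; have EZ := dual_pair_inj E E'.
  have := congr1 unzip1 EZ; have := congr1 unzip2 EZ.
  by rewrite !unzip1_zip ?unzip2_zip ?Es ?Es' // => -> ->.
case E: (dual_op j M) => [Y|] // [<-]; case E': (dual_op j M') => [Y'|] // [-> EY].
by rewrite EY in E'; rewrite (IH _ _ _ E E').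
Qed.

(** Commutation compares composites only; that [mat_f] and [mat_e] are defined on both sides at once
    also uses that [dual_op] preserves epsilon and phi. *)
Lemma dual_op_bisim j : bisim (fun M N => dual_op j M = Some N).
Proof.
have F i x y : dual_op j x = Some y -> opt_rel (fun M N => dual_op j M = Some N) (mat_f i x) (mat_f i y).
  move=> E; have := dual_op_mat_f i j x; rewrite E /=.
  case Ex: (mat_f i x) => [x'|] /= Ey; last by rewrite Ey.
  case Ey': (mat_f i y) => [y'|] /=; first by rewrite -Ey.
  by move/mat_f_None: Ey'; rewrite (dual_op_stat i E).2 => /mat_f_None; rewrite Ex.
split => //.
- by move=> x y y' -> [].
- exact: dual_op_inj.
- by move=> x y; apply: dual_op_colsum.
- move=> i x y E.
  case Ex: (mat_e i x) => [x'|] /=; last first.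
    by move/mat_e_None: Ex; rewrite -(dual_op_stat i E).1 => /mat_e_None ->.
  move/mat_f_mat_e: Ex => Ex.
  have := dual_op_mat_f i j x'; rewrite Ex /= E.
  case Ey: (dual_op j x') => [y'|] //= /mat_f_mat_e.
  by move=> ->.
Qed.

(* Sum of the indices of the rows over all ones: a termination measure for
   [dual_op]. *)
Fixpoint row_moment (M : seq (seq bool)) : nat :=
  if M is r :: M' then row_moment M' + count id (flatten M') else 0.

Lemma dual_op_row_moment j M N : dual_op j M = Some N ->
  row_moment N < row_moment M /\ count id (flatten N) = count id (flatten M).
Proof.
elim: j M N => [|j IH] [|r M] N //=; last first.
  by case E: (dual_op j M) => [Y|] // [<-] /=; have [] := IH _ _ E; rewrite !count_cat; lia.
case: M => [|s B] //; case: eqP => // Es; case E: (dual_pair _) => [W|] // [<-] /=.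
have [_] := dual_pair_count E; rewrite unzip1_zip ?unzip2_zip ?Es // !count_cat; lia.
Qed.

Lemma dual_op_size N j M M' : dual_op j M = Some M' ->
  all (fun r => size r == N) M -> size M' = size M /\ all (fun r => size r == N) M'.
Proof.
elim: j M M' => [|j IH] [|r M] M' //=; last first.
  case E: (dual_op j M) => [Y|] // [<-] /= /andP[-> H]; by have [-> ->] := IH _ _ E H.
case: M => [|s B] //; case: eqP => // Es; case E: (dual_pair _) => [W|] // [<-] /=.
case/and3P=> /eqP Hr /eqP Hs ->; split => //.
by rewrite !size_map (dual_pair_size E) size_zip Hr Hs minnn eqxx.
Qed.

Lemma extremal_exists N M : all (fun r => size r == N) M ->
  exists T U, [/\ bisim T, T M U, forall j, dual_op j U = None,
    size U = size M & all (fun r => size r == N) U].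
Proof.
have [m] := ubnP (row_moment M); elim: m M => // m IH M Hm HN.
have [|H] := classic (exists j, dual_op j M <> None).
  case=> j; case E: (dual_op j M) => [M'|] // _.
  have [S' A'] := dual_op_size E HN.
  have [||T [U [H1 H2 H3 H4 H5]]] := IH M'; rewrite ?A' //.
    by have [] := dual_op_row_moment E; lia.
  exists (fun x z => exists2 y, dual_op j x = Some y & T y z), U.
  split => //; first exact: bisim_comp (dual_op_bisim j) H1.
    by exists M'.
  by rewrite H4.
exists eq, M; split => //; first exact: bisim_eq.
by move=> j; case E: (dual_op j M) => [M'|] //; case: H; exists j; rewrite E.
Qed.

(** * Rigidity of extremal highest weight matrices *)

Definition row_sub (r s : seq bool) := forall p, nth false s p -> nth false r p.

(** The ones of [r] form an initial block. To the right of a column (0, 1) there is then no column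
    (1, 0) to cancel it, so it would be an unmatched + and [dual_pair] would apply. *)
Lemma dual_pair_nil_sub r s : size r = size s ->
  (forall p, nth false r p.+1 -> nth false r p) -> dual_pair (zip r s) = None -> row_sub r s.
Proof.
move=> Es mono /fG_None; elim: r s Es mono => [|a r IH] [|b s] //=.
  by move=> _ _ _ p; rewrite nth_nil.
case=> Es mono H.
have mono' p : nth false r p.+1 -> nth false r p by apply: (mono p.+1).
have H' : ph col_sign (zip r s) = 0 by case: ifP H.
case=> [|p] //=; last exact: IH Es mono' H' p.
case: a b H mono => [] [] //= H mono _.
have F p : nth false r p = false.
  elim: p => [|p IHp]; first by apply/negP => /(mono 0).
  by apply/negP => /mono'; rewrite IHp.
have E0 : ep col_sign (zip r s) = 0.
  elim: r s Es F {IH mono H mono' H'} => [|c r IH] [|d s] //=; case=> Es F.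
  have -> : c = false by apply: (F 0).
  by rewrite (IH s Es (fun p => F p.+1)); case: d.
by rewrite E0 in H.
Qed.

Fixpoint nested (r : seq bool) (M : seq (seq bool)) : Prop :=
  if M is s :: M' then row_sub r s /\ nested s M' else True.

Lemma no_minus_mono i s : row_sign i s <> Some false -> i.+1 < size s ->
  nth false s i.+1 -> nth false s i.
Proof. by rewrite row_signE => H Hi; move: H; rewrite Hi; case: (nth _ _ i) => //; case: (nth _ _ _). Qed.

Lemma extremal_nested N A r M :
  all (fun r => size r == N) (r :: M) ->
  (forall a, a \in A -> row_sub a r) ->
  (forall p, nth false r p.+1 -> nth false r p) ->
  (forall i, mat_e i (rcons A r ++ M) = None) ->
  (forall j, dual_op j (r :: M) = None) -> nested r M.
Proof.
elim: M A r => [|s M IH] A r //= /and3P[/eqP Hr /eqP Hs HM] HA mono He HG.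
have Ers : size r = size s by rewrite Hs.
have Srs : row_sub r s.
  apply: dual_pair_nil_sub mono _ => //.
  by have := HG 0; rewrite /= Ers eqxx; case: (dual_pair _).
have HA' a : a \in rcons A r -> row_sub a s.
  rewrite mem_rcons inE => /orP[/eqP -> //|/HA Ha] p /Srs; exact: Ha.
split=> //; apply: (IH (rcons A r)) => //=; first by rewrite Hs eqxx.
- move=> p Hp; have Hps : p.+1 < size s by case: ltnP Hp => // ?; rewrite nth_default.
  apply: (no_minus_mono _ Hps Hp) => Em.
  have /mat_e_None E0 := He p; have /hasP[a Ha /eqP] := ep0_prefix E0 Em.
  rewrite row_signE; case: ifP => // /andP[_ +] [Ea].
  by rewrite Ea (HA' _ Ha _ Hp).
- by move=> i; rewrite cat_rcons.
- by move=> j; have /= := HG j.+1; case: (dual_op _ _).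
Qed.

Lemma extremal_nested0 N r M :
  all (fun r => size r == N) (r :: M) ->
  (forall i, mat_e i (r :: M) = None) -> (forall j, dual_op j (r :: M) = None) -> nested r M.
Proof.
move=> HN He HG; apply: (@extremal_nested N [::]) => // p Hp.
have Hps : p.+1 < size r by case: ltnP Hp => // ?; rewrite nth_default.
apply: (no_minus_mono _ Hps Hp) => Em.
by have /mat_e_None E0 := He p; have := @ep0_prefix _ _ [::] _ _ E0 Em.
Qed.

Lemma nested_nth r M k p : nested r M -> k <= size M ->
  nth false (nth [::] (r :: M) k) p = (k < colsum (r :: M) p).
Proof.
rewrite /colsum; elim: M r k => [|s M IH] r k.
  by case: k => //= _ _; case: nth.
case=> Srs HM Hk; have IHk k' := IH s k' HM.
have [Hr|Hr] := boolP (nth false r p).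
  by case: k Hk => [|k] Hk; rewrite [count _ _]/= Hr //= -/(nth _ (s :: M) k) IHk // ltnS.
have Hs : nth false s p = false by apply/negP => /Srs; apply/negP.
have C0 : count (fun r => nth false r p) M = 0.
  by have := IHk 0 isT; rewrite /= Hs add0n; case: (count _ M).
rewrite /= (negbTE Hr) Hs C0; case: k Hk => [|k] Hk /=; first exact: negbTE.
by rewrite -[LHS]/(nth false (nth [::] (s :: M) k) p) IHk //= Hs C0.
Qed.

Lemma extremal_eq N M M' :
  all (fun r => size r == N) M -> all (fun r => size r == N) M' -> size M = size M' ->
  (forall i, mat_e i M = None) -> (forall j, dual_op j M = None) ->
  (forall i, mat_e i M' = None) -> (forall j, dual_op j M' = None) ->
  colsum M =1 colsum M' -> M = M'.
Proof.
case: M M' => [|r M] [|r' M'] // HN HN' Es He HG He' HG' HC.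
have n1 := extremal_nested0 HN He HG; have n2 := extremal_nested0 HN' He' HG'.
apply: (eq_from_nth (x0 := [::])) => // k Hk.
have S1 : size (nth [::] (r :: M) k) = N by apply/eqP/(allP HN)/mem_nth.
have S2 : size (nth [::] (r' :: M') k) = N by apply/eqP/(allP HN')/mem_nth; rewrite -Es.
apply: (eq_from_nth (x0 := false)); first by rewrite S1.
move=> p _; rewrite !nested_nth ?HC //; case: Es Hk => <- //.
Qed.

Lemma highest_bisim N M M' :
  all (fun r => size r == N) M -> all (fun r => size r == N) M' -> size M = size M' ->
  (forall i, mat_e i M = None) -> (forall i, mat_e i M' = None) ->
  colsum M =1 colsum M' -> exists2 T, bisim T & T M M'.
Proof.
move=> HN HN' Es He He' HC.
have [T [U [bT TU EU SU NU]]] := extremal_exists HN.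
have [T' [U' [bT' TU' EU' SU' NU']]] := extremal_exists HN'.
have [_ _ C E F] := bT; have [_ _ C' E' F'] := bT'.
have UU : U = U'.
  apply: extremal_eq NU NU' _ _ EU _ EU' _; rewrite ?SU ?SU' //.
  - by move=> i; have := F i _ _ TU; rewrite He; case: (mat_e i U).
  - by move=> i; have := F' i _ _ TU'; rewrite He'; case: (mat_e i U').
  - by move=> p; rewrite -(C _ _ TU) -(C' _ _ TU').
subst U'; exists (fun x z => exists2 y, T x y & T' z y); last by exists U.
exact: bisim_comp bT (bisim_inv bT').
Qed.

(** * Virtualization of type C words *)

Section Virtual.
Variable n : nat.
Implicit Types (x j : nat) (w : seq nat).

Definition row_of (P : pred nat) : seq bool := mkseq P (2 * n).

(* The virtual image of a letter: the subsets {x} and the complement of {bar x}. *)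
Definition letter_rows x : seq (seq bool) := [:: row_of (pred1 x); row_of (predC1 (bar n x))].

(* Padding by (empty, full) pairs, which are neutral for the crystal, makes words
   of different lengths comparable. *)
Definition virt L w : seq (seq bool) :=
  flatten (map letter_rows w) ++ flatten (nseq (L - size w) [:: row_of pred0; row_of predT]).

Lemma row_sign_row i (P : pred nat) : i.+1 < 2 * n ->
  row_sign i (row_of P) = if P i == P i.+1 then None else Some (P i).
Proof.
by move=> Hi; rewrite row_signE size_mkseq Hi !nth_mkseq ?if_neg //; lia.
Qed.

Lemma row_swap_row i (P : pred nat) : i.+1 < 2 * n ->
  row_swap i (row_of P) = row_of (fun p => P (if p == i then i.+1 else if p == i.+1 then i else p)).
Proof.
move=> Hi; have Hn r p : i.+1 < size r ->
    nth false (row_swap i r) p = nth false r (if p == i then i.+1 else if p == i.+1 then i else p).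
  elim: i r p {Hi} => [|i IH] [|a [|b r]] //= p; first by case: p => [|[|p]].
  move=> Hi; case: p => [|p] //=; rewrite IH // !eqSS.
  by do 2 case: eqP => //.
apply: (eq_from_nth (x0 := false)); rewrite size_row_swap !size_mkseq // => p Hp.
by rewrite Hn ?size_mkseq // !nth_mkseq //; do 2 case: eqP => //; lia.
Qed.

Lemma sgn_plus j x : j < n -> sgnL n j x = Some true -> x.+1 < 2 * n /\ sgnL n j x.+1 = Some false.
Proof.
rewrite /sgnL => Hj; case: ifP => [H _|_]; last by case: ifP.
split; first by lia.
by case: ifP => [|_]; first lia; case: ifP => //; lia.
Qed.

Lemma sgn_minus j x : j < n -> sgnL n j x = Some false ->
  0 < x /\ sgnL n j x.-1 = Some true.
Proof.
rewrite /sgnL => Hj; case: ifP => // H; case: ifP => // H' _.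
by split; [lia|case: ifP => //; lia].
Qed.

Definition dual j := 2 * n - 2 - j.
(** The long root: j = n-1 is fixed by [dual], both rows of a letter carry the same sign there, and
    the virtual operator is the square of a single type A operator, so epsilon and phi double. *)
Definition mult j := if j == n.-1 then 2 else 1.

Lemma row_sign_pred1 i x : i.+1 < 2 * n ->
  row_sign i (row_of (pred1 x)) = if x == i then Some true else if x == i.+1 then Some false else None.
Proof.
move=> Hi; rewrite row_sign_row //= ![_ == x]eq_sym.
by do 2 case: (x =P _) => //=; lia.
Qed.

Lemma row_sign_predC1 i x : i.+1 < 2 * n -> x < 2 * n ->
  row_sign i (row_of (predC1 (bar n x))) =
  if x == dual i then Some true else if x == 2 * n - 1 - i then Some false else None.
Proof.
move=> Hi Hx; rewrite row_sign_row //= /bar /dual.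
have -> : (i == (2 * n).-1 - x) = (x == 2 * n - 1 - i) by lia.
have -> : (i.+1 == (2 * n).-1 - x) = (x == 2 * n - 2 - i) by lia.
by do 2 case: (x =P _) => //=; lia.
Qed.

Lemma letter_rows_stat j x : j < n -> x < 2 * n ->
  (ep (row_sign j) (letter_rows x) = if sgnL n j x == Some false then mult j else 0) /\
  (ph (row_sign j) (letter_rows x) = if sgnL n j x == Some true then mult j else 0) /\
  (ep (row_sign (dual j)) (letter_rows x) = if sgnL n j x == Some false then mult j else 0) /\
  (ph (row_sign (dual j)) (letter_rows x) = if sgnL n j x == Some true then mult j else 0).
Proof.
move=> Hj Hx.
rewrite /= !row_sign_pred1 ?row_sign_predC1 /dual //; try lia.
have -> : 2 * n - 2 - (2 * n - 2 - j) = j by lia.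
have -> : 2 * n - 1 - (2 * n - 2 - j) = j.+1 by lia.
have -> : (2 * n - 2 - j).+1 = 2 * n - 1 - j by lia.
rewrite /sgnL /mult; have [->|Hn] := eqVneq j n.-1.
  have -> : n.-1.+1 = n by lia.
  have -> : 2 * n - 1 - n.-1 = n by lia.
  have -> : 2 * n - 2 - n.-1 = n.-1 by lia.
  by case: (x =P n.-1); case: (x =P n) => //=; lia.
by case: (x =P j); case: (x =P j.+1); case: (x =P 2 * n - 2 - j);
  case: (x =P 2 * n - 1 - j) => //=; lia.
Qed.

Lemma eq_row (P Q : pred nat) : (forall p, p < 2 * n -> P p = Q p) -> row_of P = row_of Q.
Proof. by move=> H; apply/eq_in_map => p; rewrite mem_iota => /andP[_]; apply: H. Qed.

Lemma row_swap_pred1 i : i.+1 < 2 * n -> row_swap i (row_of (pred1 i)) = row_of (pred1 i.+1).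
Proof. by move=> Hi; rewrite row_swap_row //; apply: eq_row => p _ /=; case: (p =P i); case: (p =P i.+1); lia. Qed.

Lemma row_swap_predC1 i x : i.+1 < 2 * n -> x = dual i ->
  row_swap i (row_of (predC1 (bar n x))) = row_of (predC1 (bar n x.+1)).
Proof.
rewrite /dual => Hi ->; rewrite row_swap_row //; apply: eq_row => p _ /=; rewrite /bar.
by case: (p =P i); case: (p =P i.+1); lia.
Qed.

Lemma letter_rows_f j x : j < n -> sgnL n j x = Some true ->
  exists2 B, mat_f j (letter_rows x) = Some B & mat_f (dual j) B = Some (letter_rows x.+1).
Proof.
move=> Hj Hx; have Hj' : j.+1 < 2 * n by lia.
have Hd : (dual j).+1 < 2 * n by rewrite /dual; lia.
have dd : dual (dual j) = j by rewrite /dual; lia.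
have d1 : 2 * n - 1 - dual j = j.+1 by rewrite /dual; lia.
have d2 : (dual j).+1 = 2 * n - 1 - j by rewrite /dual; lia.
have Hx' : x < 2 * n by have := sgn_plus Hj Hx; lia.
have Nj1 : dual j != j.+1 by rewrite /dual; lia.
have : (x == j) || (x == dual j) by move: Hx; rewrite /sgnL -/(dual j); case: ifP => // _; case: ifP.
have fM2l i r s : row_sign i r = Some true -> row_sign i s <> Some false -> mat_f i [:: r; s] = Some [:: row_swap i r; s].
  by rewrite /mat_f /= => ->; case: (row_sign i s) => [[]|].
have fM2r i r s : row_sign i r <> Some true -> row_sign i s = Some true -> mat_f i [:: r; s] = Some [:: r; row_swap i s].
  by rewrite /mat_f /= => H ->; case: eqP => //=.
have [Ej|Nj] := eqVneq (dual j) j.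
  rewrite Ej orbb => /eqP ->.
  exists [:: row_of (pred1 j.+1); row_of (predC1 (bar n j))].
    rewrite fM2l ?row_swap_pred1 ?row_sign_pred1 ?row_sign_predC1 ?eqxx //; try lia.
    by rewrite Ej eqxx.
  rewrite fM2r ?row_swap_predC1 ?row_sign_pred1 ?row_sign_predC1 ?Ej ?eqxx //; try lia.
  by do ?[case: ifP => //]; lia.
have [/eqP ->|Nx /= /eqP ->] := boolP (x == j).
  move=> _; exists [:: row_of (pred1 j.+1); row_of (predC1 (bar n j))].
    rewrite fM2l ?row_swap_pred1 ?row_sign_pred1 ?row_sign_predC1 ?eqxx //; try lia.
    by rewrite eq_sym (negbTE Nj); do ?[case: ifP => //]; lia.
  rewrite fM2r ?row_swap_predC1 ?row_sign_pred1 ?row_sign_predC1 ?dd ?eqxx //; try lia.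
  by rewrite eq_sym (negbTE Nj1) d2; do ?[case: ifP => //]; lia.
exists [:: row_of (pred1 (dual j)); row_of (predC1 (bar n (dual j).+1))].
  rewrite fM2r ?row_swap_predC1 ?row_sign_pred1 ?row_sign_predC1 ?eqxx //; try lia.
  by rewrite (negbTE Nj) (negbTE Nj1).
rewrite fM2l ?row_swap_pred1 ?row_sign_pred1 ?row_sign_predC1 ?dd ?d1 ?eqxx //; try lia.
by do ?[case: ifP => //]; lia.
Qed.

Lemma row_sign_row_swap_far i k r : i.+1 < k -> row_sign k (row_swap i r) = row_sign k r.
Proof.
elim: i k r => [|i IH] [|k] [|a r] //= Hik; last by rewrite IH.
by case: k Hik r => // k _ [|b r].
Qed.

(** Keeps the two halves of the virtual f_j together: a letter passed over by the operator at j is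
    passed over by the one at [dual j] as well. Either the two indices are too far apart to
    interact, or they coincide and epsilon grows by one. *)
Lemma ep_dual j M B : j < n -> mat_f j M = Some B ->
  ep (row_sign (dual j)) M <= ep (row_sign (dual j)) B.
Proof.
move=> Hj E; have [Ej|Nj] := eqVneq (dual j) j.
  rewrite Ej (fG_ep (up := row_swap j) _ E) // => r Hr.
  by rewrite row_sign_row_swap Hr row_swapK.
have Hd : j.+1 < dual j by move: Nj; rewrite /dual; lia.
have := fG_stat (g := row_sign (dual j)) _ E => H.
rewrite -(ep_map (row_sign (dual j)) B) H ?ep_map // => r _.
by rewrite row_sign_row_swap_far.
Qed.

Section Padded.
Variable P : seq (seq bool).
Hypothesis Pep : forall i, ep (row_sign i) P = 0.
Hypothesis Pph : forall i, ph (row_sign i) P = 0.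

Lemma virt_cons_pad x w : flatten (map letter_rows (x :: w)) ++ P = letter_rows x ++ (flatten (map letter_rows w) ++ P).
Proof. by []. Qed.

(** The statistics of every letter at j and at [dual j] are scaled by the same factor [mult j], and
    the cancellation of + against - is compatible with scaling. *)
Lemma virt_ep_pad j w : j < n -> all (fun x => x < 2 * n) w ->
  ep (row_sign j) (flatten (map letter_rows w) ++ P) = mult j * ep (sgnL n j) w /\
  ep (row_sign (dual j)) (flatten (map letter_rows w) ++ P) = mult j * ep (sgnL n j) w.
Proof.
move=> Hj; elim: w => [|x w IH]; first by rewrite /= !Pep muln0.
case/andP=> Hx /IH {IH} [IH1 IH2]; have [b1 [b2 [b3 b4]]] := letter_rows_stat Hj Hx.
rewrite virt_cons_pad (ep_cat (row_sign j) (letter_rows x)) (ep_cat (row_sign (dual j)) (letter_rows x)) IH1 IH2 b1 b2 b3 b4 [ep _ (_ :: _)]/=.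
have : 0 < mult j by rewrite /mult; case: ifP.
by case: (sgnL n j x) => [[]|] //=; case: (ep _ w) => [|e]; rewrite /= ?mulnS ?muln0; lia.
Qed.

Lemma virt_f_pad j w w' : j < n -> all (fun x => x < 2 * n) w -> fL n j w = Some w' ->
  exists2 B, mat_f j (flatten (map letter_rows w) ++ P) = Some B &
             mat_f (dual j) B = Some (flatten (map letter_rows w') ++ P).
Proof.
rewrite fLE => Hj; elim: w w' => [|x w IH] // w' /andP[Hx Hw].
have [b1 [b2 [b3 b4]]] := letter_rows_stat Hj Hx; have [e1 e2] := virt_ep_pad Hj Hw.
have m0 : 0 < mult j by rewrite /mult; case: ifP.
rewrite virt_cons_pad [fG _ _ _]/=; case: ifP => [/andP[/eqP Ex /eqP Ew]|Hxw].
  case=> <-; have [B B1 B2] := letter_rows_f Hj Ex.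
  exists (B ++ flatten (map letter_rows w) ++ P).
    rewrite /mat_f fG_cat -/(mat_f j (letter_rows x)) B1 e1 Ew muln0 b2 Ex eqxx m0 //.
  rewrite virt_cons_pad /mat_f fG_cat -/(mat_f (dual j) B) B2 e2 Ew muln0.
  case: ltnP => //; rewrite leqn0 => /eqP /mat_f_None; by rewrite B2.
case E: (fG _ _ w) => [w1|] // [<-].
have [B B1 B2] := IH _ Hw E.
rewrite virt_cons_pad; have le1 : (ph (row_sign j) (letter_rows x) <= mult j * ep (sgnL n j) w) /\
  (ph (row_sign (dual j)) (letter_rows x) <= mult j * ep (sgnL n j) w).
  rewrite b2 b4; case: eqP Hxw => //= _; case: (ep _ w) => // e _.
  by rewrite mulnS leq_addr.
exists (letter_rows x ++ B).
  by rewrite /mat_f fG_cat -/(mat_f j (_ ++ P)) B1 e1 ltnNge le1.1.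
rewrite /mat_f fG_cat -/(mat_f (dual j) B) B2 ltnNge.
by rewrite (leq_trans _ (ep_dual Hj B1)) // e2 le1.2.
Qed.

Lemma virt_f_None_pad j w : j < n -> all (fun x => x < 2 * n) w -> fL n j w = None ->
  mat_f j (flatten (map letter_rows w) ++ P) = None.
Proof.
rewrite fLE => Hj Hw /fG_None Hph; apply/mat_f_None; elim: w Hw Hph => [|x w IH] //.
case/andP=> Hx Hw; rewrite virt_cons_pad.
have [b1 [b2 [b3 b4]]] := letter_rows_stat Hj Hx; have [e1 e2] := virt_ep_pad Hj Hw.
rewrite ph_cat e1 b2 [ph _ (_ :: _)]/=.
case: (sgnL n j x == Some true) => /= [|/(IH Hw) -> //].
case: eqP => // He /(IH Hw) ->; case: (ep _ w) He => // e _.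
by rewrite mulnS; lia.
Qed.

Lemma virt_e_None_pad j w : j < n -> all (fun x => x < 2 * n) w -> eL n j w = None ->
  mat_e j (flatten (map letter_rows w) ++ P) = None /\ mat_e (dual j) (flatten (map letter_rows w) ++ P) = None.
Proof.
rewrite eLE => Hj Hw /eG_None He; have [e1 e2] := virt_ep_pad Hj Hw.
by rewrite He muln0 in e1 e2; split; apply/mat_e_None.
Qed.

End Padded.
End Virtual.

(** * Plactic equivalence of highest weight words *)

Section PlacticHighest.
Variable n : nat.
Implicit Types (x y w u v : seq nat) (j : nat).

Lemma fL_eL j x y : j < n -> fL n j x = Some y <-> eL n j y = Some x.
Proof.
move=> Hj; rewrite fLE eLE; split.
- by apply: fG_eG => a /(sgn_plus Hj) [_ ->].
- apply: eG_fG => a; first by move/(sgn_plus Hj) => [_ ->].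
  by case: a => [|a] /(sgn_minus Hj) [].
Qed.

Definition letters w := all (fun a => a < 2 * n) w.

Lemma fL_letters j x y : j < n -> fL n j x = Some y -> letters x = letters y.
Proof.
move=> Hj; rewrite fLE; elim: x y => [|a x IH] y //=; case: ifP => [/andP[/eqP Ea _]|_].
  case=> <- /=; rewrite (sgn_plus Hj Ea).1; have := (sgn_plus Hj Ea).1.
  by move=> H; rewrite (ltnW H).
by case E: (fG _ _ x) => [z|] // [<-] /=; rewrite (IH _ E).
Qed.

Lemma fL_sz j x y : fL n j x = Some y -> size y = size x.
Proof. by rewrite fLE; apply: fG_size. Qed.

Definition word_bisim (S : seq nat -> seq nat -> Prop) : Prop :=
  [/\ forall x y y', S x y -> S x y' -> y = y',
      forall x x' y, S x y -> S x' y -> x = x',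
      forall x y, S x y -> wtL n x = wtL n y,
      forall j x y, j < n -> S x y -> opt_rel S (fL n j x) (fL n j y)
    & forall j x y, j < n -> S x y -> opt_rel S (eL n j x) (eL n j y)].

Lemma word_bisim_inv S : word_bisim S -> word_bisim (fun x y => S y x).
Proof.
move=> [H1 H2 H3 H4 H5]; split => //.
- by move=> x y y' A B; apply: H2 A B.
- by move=> x y y' A B; apply: H1 A B.
- by move=> x y /H3 E.
- by move=> j x y Hj /(H4 j _ _ Hj); case: (fL n j x); case: (fL n j y).
- by move=> j x y Hj /(H5 j _ _ Hj); case: (eL n j x); case: (eL n j y).
Qed.

(** Back and forth along the arrows: one related pair makes [S] total on the component of its first
    word and surjective onto that of its second. *)
Lemma conn_word_bisim S : word_bisim S -> forall x x', connL n x x' ->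
  (forall y, S x y -> exists2 y', connL n y y' & S x' y') /\
  (forall y', S x' y' -> exists2 y, connL n y' y & S x y).
Proof.
move=> [_ _ _ H4 H5] x x'; elim=> [a b [j Hj Ea]|a|a b _ [IH1 IH2]|a b c _ [IH1 IH2] _ [IH3 IH4]].
- split=> [y /(H4 _ _ _ Hj)|y' Sy].
    rewrite Ea; case Ey: (fL n j y) => [y'|] // Sy'; exists y' => //.
    by apply: rst_step; exists j.
  move/(fL_eL _ _ Hj): Ea => Ea; have := H5 _ _ _ Hj Sy; rewrite Ea.
  case Ey: (eL n j y') => [y|] // Sy'; exists y => //.
  by apply: rst_sym; apply: rst_step; exists j => //; apply/fL_eL.
- by split=> y Sy; exists y => //; apply: rst_refl.
- by split.
- split=> [y /IH1 [y' C1 /IH3 [y'' C2 S2]]|y'' /IH4 [y' C1 /IH2 [y C2 S2]]].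
    by exists y'' => //; apply: rst_trans C1 C2.
  by exists y => //; apply: rst_trans C1 C2.
Qed.

(** [plac] asks for a total function. On the component of [u] the relation [S] is functional and
    total, so choice yields [phi]; its values elsewhere are arbitrary. *)
Lemma plac_of_word_bisim S u v : word_bisim S -> S u v -> plac n u v.
Proof.
move=> bS Suv; have [H1 H2 H3 H4 H5] := bS.
pose phi x := epsilon (inhabits [::]) (S x).
have phiE x y : S x y -> phi x = y.
  by move=> Sxy; apply: (H1 x) => //; apply: epsilon_spec; exists y.
have ex x : connL n u x -> S x (phi x).
  by case/(conn_word_bisim bS) => /(_ _ Suv) [y _ Sxy] _; rewrite (phiE _ _ Sxy).
exists phi; split.
- exact: phiE.
- move=> x /ex Sx; split=> [|j Hj]; first by rewrite (H3 _ _ Sx).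
  split.
    by have := H4 _ _ _ Hj Sx; case: (fL n j x) => [a|]; case: (fL n j (phi x)) => [b|] //= /phiE ->.
  by have := H5 _ _ _ Hj Sx; case: (eL n j x) => [a|]; case: (eL n j (phi x)) => [b|] //= /phiE ->.
- by move=> x y /ex Sx /ex Sy E; rewrite E in Sx; apply: H2 Sx Sy.
- move=> y /(conn_word_bisim (word_bisim_inv bS)) [/(_ _ Suv) [x Cx Sx] _].
  by exists x => //; apply: phiE.
Qed.

Definition pad k : seq (seq bool) := flatten (nseq k [:: row_of n pred0; row_of n predT]).

Lemma row_sign_pad i r : r \in pad i -> forall k, row_sign k r = None.
Proof.
have H P b : (forall p, P p = b) -> forall k, row_sign k (row_of n P) = None.
  move=> HP k; rewrite row_signE size_mkseq; case: ltnP => //= Hk.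
  by rewrite !nth_mkseq ?HP ?eqxx //; lia.
rewrite /pad; elim: i => //= i IH; rewrite !inE => /or3P[/eqP ->|/eqP ->|/IH //].
  by apply: (H _ false).
by apply: (H _ true).
Qed.

Lemma pad_stat k i : ep (row_sign i) (pad k) = 0 /\ ph (row_sign i) (pad k) = 0.
Proof.
have := row_sign_pad (i := k); elim: (pad k) => //= r M IH H.
rewrite !(H r) ?inE ?eqxx //; apply: IH => s Hs; apply: H.
by rewrite inE Hs orbT.
Qed.

Lemma virtE L w : virt n L w = flatten (map (letter_rows n) w) ++ pad (L - size w).
Proof. by []. Qed.

Lemma pad_ep k i : ep (row_sign i) (pad k) = 0. Proof. exact: (pad_stat k i).1. Qed.
Lemma pad_ph k i : ph (row_sign i) (pad k) = 0. Proof. exact: (pad_stat k i).2. Qed.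

Lemma virt_inj L w w' : letters w -> letters w' -> size w = size w' ->
  virt n L w = virt n L w' -> w = w'.
Proof.
rewrite !virtE; move: (pad (L - size w)) (pad (L - size w')) => P P'.
elim: w w' => [|a w IH] [|b w'] //= /andP[Ha Hw] /andP[Hb Hw'] [Es] [E1 _ E2].
rewrite (IH w') //; congr cons; have := congr1 (fun r => nth false r a) E1.
by rewrite !nth_mkseq //= eqxx => /esym/eqP.
Qed.

Lemma nth_row (P : pred nat) p : nth false (row_of n P) p = (p < 2 * n) && P p.
Proof. by case: ltnP => Hp; [rewrite nth_mkseq|rewrite nth_default ?size_mkseq]. Qed.

(** A letter contributes 1 to every column, one more at itself and one less at its bar; a padding
    pair contributes 1 to every column. So the column sums are the weight shifted by the constant
    [L], whatever the length of the word. *)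
Lemma colsum_virt L w p : size w <= L -> letters w ->
  colsum (virt n L w) p + (p < 2 * n) * count_mem (bar n p) w =
  (p < 2 * n) * (count_mem p w + L).
Proof.
move=> + Hw; rewrite virtE /colsum count_cat => Hs.
have -> : count (fun r => nth false r p) (pad (L - size w)) = (p < 2 * n) * (L - size w).
  rewrite /pad; elim: (L - size w) => [|k IH]; first by rewrite muln0.
  by rewrite /= !nth_row andbF andbT IH mulnS.
have : count (fun r => nth false r p) (flatten (map (letter_rows n) w)) + (p < 2 * n) * count_mem (bar n p) w =
    (p < 2 * n) * (count_mem p w + size w).
  elim: w Hw {Hs} => [|a w IH] /=; first by rewrite muln0.
  move=> /andP[Ha /IH]; rewrite !nth_row /=; case: (ltnP p (2 * n)) => Hp; last by rewrite !mul0n.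
  rewrite !mul1n !andTb [p == a]eq_sym.
  have -> : (p != bar n a) = ~~ (a == bar n p) by rewrite /bar; lia.
  by case: (a == bar n p); case: (a == p); lia.
by case: (p < 2 * n); lia.
Qed.

Lemma wtL_eq u v : letters u -> letters v ->
  wtL n u = wtL n v <-> forall z, z < 2 * n ->
    count_mem z u + count_mem (bar n z) v = count_mem z v + count_mem (bar n z) u.
Proof.
move=> Hu Hv; split=> [|H].
  rewrite /wtL => /eq_in_map H z Hz.
  case: (ltnP z n) => Hzn; first by have := H z; rewrite mem_iota => /(_ Hzn); lia.
  have := H (bar n z); rewrite mem_iota.
  have -> : bar n (bar n z) = z by rewrite /bar; lia.
  by rewrite /bar => HH; have := HH ltac:(lia); lia.
apply/eq_in_map => z; rewrite mem_iota => /andP[_ Hz].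
by have := H z ltac:(lia); lia.
Qed.

Lemma virt_word_bisim L a b T : bisim T -> a <= L -> b <= L ->
  word_bisim (fun x y => [/\ letters x /\ size x = a, letters y /\ size y = b
                     & T (virt n L x) (virt n L y)]).
Proof.
move=> [T1 T2 T3 T4 T5] La Lb; split.
- move=> x y y' [_ [Hy Sy] Txy] [_ [Hy' Sy'] Txy'].
  by apply: (virt_inj (L := L)) => //; [rewrite Sy|apply: T1 Txy Txy'].
- move=> x y y' [[Hy Sy] _ Txy] [[Hy' Sy'] _ Txy'].
  by apply: (virt_inj (L := L)) => //; [rewrite Sy|apply: T2 Txy Txy'].
- move=> x y [[Hx Sx] [Hy Sy] Txy]; apply/wtL_eq => // z Hz.
  have := @colsum_virt L _ z _ Hx; have := @colsum_virt L _ z _ Hy.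
  by rewrite (T3 _ _ Txy) Hz Sx Sy => /(_ Lb) + /(_ La); lia.
- move=> j x y Hj [[Hx Sx] [Hy Sy] Txy].
  have F w w' : letters w -> fL n j w = Some w' ->
      exists2 B, mat_f j (virt n L w) = Some B & mat_f (dual n j) B = Some (virt n L w').
    move=> Hw E; rewrite !virtE (fL_sz E).
    by apply: virt_f_pad => //; exact: pad_ep.
  have FN w : letters w -> fL n j w = None -> mat_f j (virt n L w) = None.
    by move=> Hw E; apply: virt_f_None_pad => //; [exact: pad_ep|exact: pad_ph].
  have := T4 j _ _ Txy; case Ex: (fL n j x) => [x'|].
    have [B B1 B2] := F _ _ Hx Ex; rewrite B1.
    case Ey: (fL n j y) => [y'|]; last by rewrite (FN _ Hy Ey).
    have [C C1 C2] := F _ _ Hy Ey; rewrite C1 => TBC /=.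
    (* The intermediate matrices [B] and [C] need not be images of words; [T] relates them because
       it lives on all matrices. *)
    have := T4 (dual n j) _ _ TBC; rewrite B2 C2 => TT.
    by rewrite -(fL_letters Hj Ex) -(fL_letters Hj Ey) (fL_sz Ex) (fL_sz Ey).
  rewrite (FN _ Hx Ex); case Ey: (fL n j y) => [y'|] //.
  by have [C -> _] := F _ _ Hy Ey.
- move=> j x y Hj [[Hx Sx] [Hy Sy] Txy].
  (* The virtual e_j undoes the operator at j followed by the one at [dual j], hence starts with
     [dual j]. *)
  have F w w' : letters w -> eL n j w = Some w' ->
      [/\ letters w', size w' = size w & exists2 B, mat_e (dual n j) (virt n L w) = Some B & mat_e j B = Some (virt n L w')].
    move=> Hw /(fL_eL _ _ Hj) E; have Hw' : letters w' by rewrite (fL_letters Hj E).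
    rewrite (fL_sz E); split => //.
    have [B B1 B2] := virt_f_pad (pad_ep (L - size w)) Hj Hw' E.
    by exists B; apply/mat_f_mat_e; rewrite // virtE -(fL_sz E).
  have FN w : letters w -> eL n j w = None -> mat_e (dual n j) (virt n L w) = None.
    by move=> Hw E; apply: (virt_e_None_pad _ Hj Hw E).2; exact: pad_ep.
  have := T5 (dual n j) _ _ Txy; case Ex: (eL n j x) => [x'|].
    have [Lx Zx [B B1 B2]] := F _ _ Hx Ex; rewrite B1.
    case Ey: (eL n j y) => [y'|]; last by rewrite (FN _ Hy Ey).
    have [Ly Zy [C C1 C2]] := F _ _ Hy Ey; rewrite C1 => TBC /=.
    have := T5 j _ _ TBC; rewrite B2 C2 => TT.
    by rewrite Zx Zy.
  rewrite (FN _ Hx Ex); case Ey: (eL n j y) => [y'|] //.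
  by have [_ _ [C -> _]] := F _ _ Hy Ey.
Qed.

Theorem plac_highest u v : letters u -> letters v ->
  (forall j, j < n -> eL n j u = None) -> (forall j, j < n -> eL n j v = None) ->
  wtL n u = wtL n v -> plac n u v.
Proof.
move=> Hu Hv Eu Ev Ew; pose L := maxn (size u) (size v).
have Lu : size u <= L by rewrite leq_maxl.
have Lv : size v <= L by rewrite leq_maxr.
have R w : all (fun r => size r == 2 * n) (virt n L w).
  rewrite virtE all_cat; apply/andP; split.
    by elim: w => //= a w ->; rewrite !size_mkseq !eqxx.
  by rewrite /pad; elim: (L - size w) => //= k ->; rewrite !size_mkseq !eqxx.
have S w : size w <= L -> size (virt n L w) = 2 * L.
  move=> Hw; rewrite virtE size_cat.
  have -> : size (pad (L - size w)) = 2 * (L - size w).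
    by rewrite /pad; elim: (L - size w) => [|k IH] //=; rewrite IH; lia.
  have -> : size (flatten (map (letter_rows n) w)) = 2 * size w.
    by elim: w {Hw} => [|a w IH] //=; rewrite IH; lia.
  lia.
have He w : letters w -> (forall j, j < n -> eL n j w = None) -> forall i, mat_e i (virt n L w) = None.
  move=> Hw Ew' i; rewrite virtE.
  case: (ltnP i n) => Hi.
    by apply: (virt_e_None_pad _ Hi Hw (Ew' _ Hi)).1; exact: pad_ep.
  case: (ltnP i.+1 (2 * n)) => Hi'.
    have Hj : 2 * n - 2 - i < n by lia.
    have -> : i = dual n (2 * n - 2 - i) by rewrite /dual; lia.
    by apply: (virt_e_None_pad _ Hj Hw (Ew' _ Hj)).2; exact: pad_ep.
  apply/mat_e_None; rewrite -virtE; elim: (virt n L w) (R w) => //= r M IH /andP[/eqP Hr /IH ->].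
  by rewrite row_signE Hr ltnNge Hi'.
have [||||||T bT TT] := @highest_bisim (2 * n) (virt n L u) (virt n L v).
- exact: R.
- exact: R.
- by rewrite !S.
- exact: He.
- exact: He.
- move=> p; have := colsum_virt p Lu Hu; have := colsum_virt p Lv Hv.
  have := proj1 (wtL_eq Hu Hv) Ew p; case: (p < 2 * n); last by lia.
  by move=> /(_ isT); lia.
exact: plac_of_word_bisim (virt_word_bisim bT Lu Lv) _.
Qed.
End PlacticHighest.

(** * Columns as subsets of the alphabet *)

Lemma neutral_stat (L : eqType) (sg : L -> option bool) w :
  {in w, forall x, sg x = None} -> ep sg w = 0 /\ ph sg w = 0.
Proof.
elim: w => //= x w IH H; rewrite H ?inE ?eqxx //=; apply: IH => y Hy; apply: H.
by rewrite inE Hy orbT.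
Qed.

Section Columns.
Variable n : nat.
Implicit Types (P Q : pred nat) (j a m : nat).

Definition colP P : seq nat := [seq x <- iota 0 (2 * n) | P x].

Definition N P m : nat := count P (iota 0 m).

Definition swap_pred a P : pred nat := fun x => P (if x == a then a.+1 else if x == a.+1 then a else x).

Lemma colP_mem c : sorted ltn c -> all (fun x => x < 2 * n) c -> c = colP (mem c).
Proof.
move=> Hs Ha; apply: (irr_sorted_eq ltn_trans ltnn) => //.
  by apply: sorted_filter (iota_ltn_sorted 0 _); apply: ltn_trans.
move=> x; rewrite mem_filter mem_iota /=; case: (boolP (x \in c)) => // Hx.
by rewrite (allP Ha _ Hx).
Qed.

Lemma mem_colP P x : (x \in colP P) = P x && (x < 2 * n).
Proof. by rewrite mem_filter mem_iota. Qed.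

Lemma sorted_colP P : sorted ltn (colP P).
Proof. by apply: sorted_filter (iota_ltn_sorted 0 _); apply: ltn_trans. Qed.

Lemma colP_lt P : all (fun x => x < 2 * n) (colP P).
Proof. by apply/allP => x; rewrite mem_colP => /andP[]. Qed.

Lemma N_S P m : N P m.+1 = N P m + P m.
Proof. by rewrite /N -addn1 iotaD count_cat /= addn0 add0n. Qed.

Lemma N_colP P m : m <= 2 * n -> count (fun x => x < m) (colP P) = N P m.
Proof.
move=> Hm; rewrite /colP -(subnKC Hm) iotaD filter_cat count_cat /N.
have -> : count (fun x => x < m) [seq x <- iota (0 + m) (2 * n - m) | P x] = 0.
  apply/eqP; rewrite -leqn0 leqNgt -has_count; apply/hasPn => x.
  by rewrite mem_filter mem_iota => /andP[_ /andP[]]; lia.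
rewrite addn0 count_filter; apply: eq_in_count => x; rewrite mem_iota /= => ->.
by rewrite andTb.
Qed.

Lemma size_colP P : size (colP P) = N P (2 * n).
Proof. by rewrite size_filter. Qed.

Lemma swap_pred_l a P : swap_pred a P a = P a.+1.
Proof. by rewrite /swap_pred eqxx. Qed.

Lemma swap_pred_r a P : swap_pred a P a.+1 = P a.
Proof. by rewrite /swap_pred eqxx; case: eqP => // /eqP; rewrite gtn_eqF. Qed.

Lemma swap_pred_off a P x : x != a -> x != a.+1 -> swap_pred a P x = P x.
Proof. by rewrite /swap_pred => /negbTE-> /negbTE->. Qed.

Lemma N_swap_pred a P m : N (swap_pred a P) m + (m == a.+1) * P a = N P m + (m == a.+1) * P a.+1.
Proof.
elim: m => [|m IH]; first by rewrite /N.
rewrite !N_S eqSS.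
have -> : swap_pred a P m = P (if m == a then a.+1 else if m == a.+1 then a else m) by []; move: IH.
case: (m =P a) => [->|Hma] /=; first by rewrite (ltn_eqF (ltnSn a)); lia.
by case: (m =P a.+1) => [->|Hma'] /=; lia.
Qed.

Definition seg P a k : seq nat := [seq x <- iota a k | P x].

Lemma seg_cat P a k l : seg P a (k + l) = seg P a k ++ seg P (a + k) l.
Proof. by rewrite /seg iotaD filter_cat. Qed.

Lemma seg_neutral j P a k : (forall x, a <= x < a + k -> sgnL n j x = None) ->
  ep (sgnL n j) (seg P a k) = 0 /\ ph (sgnL n j) (seg P a k) = 0.
Proof. by move=> H; apply: neutral_stat => x; rewrite mem_filter mem_iota => /andP[_ /H]. Qed.

Lemma seg_eq P Q a k : (forall x, a <= x < a + k -> P x = Q x) -> seg P a k = seg Q a k.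
Proof. by move=> H; apply: eq_in_filter => x; rewrite mem_iota => /H. Qed.

Lemma colP_split P j : j.+1 < n -> colP P = seg P 0 j ++ seg P j 2 ++
  seg P j.+2 (2 * n - 2 - j - j.+2) ++ seg P (2 * n - 2 - j) 2 ++ seg P (2 * n - j) j.
Proof.
move=> Hj; rewrite /colP -/(seg P 0 (2 * n)).
have {1}-> : 2 * n = j + (2 + ((2 * n - 2 - j - j.+2) + (2 + j))) by lia.
rewrite !seg_cat; congr (_ ++ (_ ++ (_ ++ (_ ++ _)))); congr seg; lia.
Qed.

Lemma colP_splitn P j : j.+1 = n -> colP P = seg P 0 j ++ seg P j 2 ++ seg P j.+2 j.
Proof.
move=> Hj; rewrite /colP -/(seg P 0 (2 * n)).
have {1}-> : 2 * n = j + (2 + j) by lia.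
rewrite !seg_cat; congr (_ ++ (_ ++ _)); congr seg; lia.
Qed.

Lemma seg2 P a : seg P a 2 = nseq (P a) a ++ nseq (P a.+1) a.+1.
Proof. by rewrite /seg /=; case: (P a); case: (P a.+1). Qed.

Lemma sgnL_at j : j < n ->
  [/\ sgnL n j j = Some true, sgnL n j j.+1 = Some false,
      sgnL n j (2 * n - 2 - j) = Some true & sgnL n j (2 * n - 2 - j).+1 = Some false].
Proof.
move=> Hj; rewrite /sgnL !eqxx orbT; split => //.
- by case: ifP => //; lia.
- have -> : (2 * n - 2 - j).+1 = 2 * n - 1 - j by lia.
  by rewrite eqxx orbT; case: ifP => //; lia.
Qed.

Lemma sgnL_off j x : x != j -> x != j.+1 -> x != 2 * n - 2 - j -> x != 2 * n - 1 - j ->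
  sgnL n j x = None.
Proof. by rewrite /sgnL => /negbTE-> /negbTE-> /negbTE-> /negbTE->. Qed.

(** Letters j and j+1 that are both present cancel, and so do their bars. What remains is at most
    one sign from the unbarred block and one from the barred block, and a + of the former cancels
    with a - of the latter. For j+1 = n the two blocks coincide, whence the guards [j.+1 < n]. *)
Definition colf j P : option (pred nat) :=
  if [&& P j, ~~ P j.+1 & ~~ [&& j.+1 < n, P (2 * n - 1 - j) & ~~ P (2 * n - 2 - j)]]
  then Some (swap_pred j P)
  else if [&& j.+1 < n, P (2 * n - 2 - j) & ~~ P (2 * n - 1 - j)]
  then Some (swap_pred (2 * n - 2 - j) P) else None.

Definition cole j P : option (pred nat) :=
  if [&& j.+1 < n, P (2 * n - 1 - j), ~~ P (2 * n - 2 - j) & ~~ (P j && ~~ P j.+1)]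
  then Some (swap_pred (2 * n - 2 - j) P)
  else if P j.+1 && ~~ P j then Some (swap_pred j P) else None.

Definition colep j P : nat :=
  (P j.+1 && ~~ P j) +
  [&& j.+1 < n, P (2 * n - 1 - j), ~~ P (2 * n - 2 - j) & ~~ (P j && ~~ P j.+1)].

Definition colph j P : nat :=
  [&& j.+1 < n, P (2 * n - 2 - j) & ~~ P (2 * n - 1 - j)] +
  [&& P j, ~~ P j.+1 & ~~ [&& j.+1 < n, P (2 * n - 1 - j) & ~~ P (2 * n - 2 - j)]].

Lemma colP_stat j P : j < n ->
  [/\ ep (sgnL n j) (colP P) = colep j P, ph (sgnL n j) (colP P) = colph j P,
      fL n j (colP P) = omap colP (colf j P) & eL n j (colP P) = omap colP (cole j P)].
Proof.
move=> Hj; have [s1 s2 s3 s4] := sgnL_at Hj.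
rewrite fLE eLE /colep /colph /colf /cole.
case: (ltnP j.+1 n) => Hjn; last first.
  have En : j.+1 = n by lia.
  rewrite (colP_splitn P En) !andFb /= addn0 add0n.
  have [a1 a2] : ep (sgnL n j) (seg P 0 j) = 0 /\ ph (sgnL n j) (seg P 0 j) = 0.
    by apply: seg_neutral => x Hx; apply: sgnL_off; lia.
  have [b1 b2] : ep (sgnL n j) (seg P j.+2 j) = 0 /\ ph (sgnL n j) (seg P j.+2 j) = 0.
    by apply: seg_neutral => x Hx; apply: sgnL_off; lia.
  have sw : colP (swap_pred j P) = seg P 0 j ++ seg (swap_pred j P) j 2 ++ seg P j.+2 j.
    rewrite (colP_splitn _ En); congr (_ ++ (_ ++ _)); apply: seg_eq => x Hx;
    by apply: swap_pred_off; lia.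
  have b3 := proj2 (fG_None _ succn _) b2; have b4 := proj2 (eG_None _ predn _) b1.
  have a3 := proj2 (fG_None _ succn _) a2; have a4 := proj2 (eG_None _ predn _) a1.
  rewrite !ep_cat !ph_cat !fG_cat !eG_cat ?ep_cat ?ph_cat a1 a2 b1 b2 a3 a4 b3 b4 !seg2.
  by case E1: (P j); case E2: (P j.+1);
    rewrite /= ?s1 ?s2 /= ?sw ?seg2 ?swap_pred_l ?swap_pred_r ?E1 ?E2 //= ?s1 ?s2.
have dS : (2 * n - 2 - j).+1 = 2 * n - 1 - j by lia.
rewrite (colP_split P Hjn) !andTb.
set A := seg P 0 j; set B := seg P j.+2 _; set C := seg P (2 * n - j) j.
have [a1 a2] : ep (sgnL n j) A = 0 /\ ph (sgnL n j) A = 0.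
  by apply: seg_neutral => x Hx; apply: sgnL_off; lia.
have [b1 b2] : ep (sgnL n j) B = 0 /\ ph (sgnL n j) B = 0.
  by apply: seg_neutral => x Hx; apply: sgnL_off; lia.
have [c1 c2] : ep (sgnL n j) C = 0 /\ ph (sgnL n j) C = 0.
  by apply: seg_neutral => x Hx; apply: sgnL_off; lia.
have sw1 : colP (swap_pred j P) = A ++ seg (swap_pred j P) j 2 ++ B ++ seg P (2 * n - 2 - j) 2 ++ C.
  rewrite (colP_split _ Hjn); congr (_ ++ (_ ++ (_ ++ (_ ++ _)))); apply: seg_eq => x Hx;
  by apply: swap_pred_off; lia.
have sw2 : colP (swap_pred (2 * n - 2 - j) P) =
    A ++ seg P j 2 ++ B ++ seg (swap_pred (2 * n - 2 - j) P) (2 * n - 2 - j) 2 ++ C.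
  rewrite (colP_split _ Hjn); congr (_ ++ (_ ++ (_ ++ (_ ++ _)))); apply: seg_eq => x Hx;
  by apply: swap_pred_off; lia.
have a3 := proj2 (fG_None _ succn _) a2; have a4 := proj2 (eG_None _ predn _) a1.
have b3 := proj2 (fG_None _ succn _) b2; have b4 := proj2 (eG_None _ predn _) b1.
have c3 := proj2 (fG_None _ succn _) c2; have c4 := proj2 (eG_None _ predn _) c1.
rewrite -dS; rewrite !seg2 ?swap_pred_l ?swap_pred_r in sw1 sw2 *.
set d := 2 * n - 2 - j in s3 s4 sw1 sw2 *.
rewrite !ep_cat !ph_cat !fG_cat !eG_cat ?ep_cat ?ph_cat a1 a2 b1 b2 c1 c2 a3 a4 b3 b4 c3 c4.
by case E1: (P j) sw1 sw2; case E2: (P j.+1); case E3: (P d); case E4: (P d.+1) => /= sw1 sw2;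
    rewrite /= ?s1 ?s2 ?s3 ?s4 /= ?s1 ?s2 ?s3 ?s4 /= ?sw1 ?sw2 //= ?s1 ?s2 ?s3 ?s4.
Qed.
End Columns.

(** * Invariance of admissibility and of the tableau condition *)

Section Tab.
Variable n : nat.
Implicit Types (P Q : pred nat) (j a m : nat).

(* In terms of c = colP P, [adm] says that c has at most m letters in
   {1 .. m} and its bars. [tab P Q] unfolds rc <= lc for the columns Q (left) and P
   (right): a deficit #{z in zs | z >= m} - #{t in ts | t >= m} is the maximum over
   m' >= m of (#pairs - #free positions) in [m, m'), see [deficit_ge] and
   [deficit_attained]. *)
Definition adm P := forall m, m <= n -> N P m + N P (2 * n) <= N P (2 * n - m) + m.

Definition tab P Q := forall m m', m <= m' -> m' <= n ->
  N P m' + N P (2 * n - m) <= N Q m + N P (2 * n - m') + (m' - m) /\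
  N P (2 * n - m) + N Q m' <= N Q m + N Q (2 * n - m') + (m' - m).

Lemma N_incr P j : j < n ->
  [/\ N P j.+1 = N P j + P j,
      N P j.+2 = N P j.+1 + P j.+1,
      N P (2 * n - j) = N P (2 * n - j.+1) + P (2 * n - 1 - j)
    & N P (2 * n - j.+1) = N P (2 * n - j.+2) + P (2 * n - 2 - j)].
Proof.
move=> Hj; have -> : 2 * n - j = (2 * n - 1 - j).+1 by lia.
have -> : 2 * n - 1 - j = (2 * n - 2 - j).+1 by lia.
have -> : 2 * n - j.+1 = (2 * n - 2 - j).+1 by lia.
have -> : 2 * n - j.+2 = 2 * n - 2 - j by lia.
by rewrite !N_S.
Qed.

Lemma N_lower P a m : P a -> ~~ P a.+1 -> N P m = N (swap_pred a P) m + (m == a.+1).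
Proof. by move=> Ha Hb; have := N_swap_pred a P m; rewrite Ha (negbTE Hb); case: (m == _); lia. Qed.

(** Besides the single index where the counting function drops, each case records why f_j chose this
    block; the invariance of the inequalities fails without that information. *)
Lemma colf_cases j P P' : j < n -> colf n j P = Some P' ->
  [/\ P j, ~~ P j.+1, j.+1 < n -> P (2 * n - 1 - j) -> P (2 * n - 2 - j)
    & forall m, N P m = N P' m + (m == j.+1)] \/
  [/\ j.+1 < n, P (2 * n - 2 - j) /\ ~~ P (2 * n - 1 - j), P j -> P j.+1
    & forall m, N P m = N P' m + (m == 2 * n - j.+1)].
Proof.
rewrite /colf => Hj; case: ifP => [/and3P[H1 H2 H3] [<-]|H].
  left; split=> // [Hn Hd|m]; last exact: N_lower.
  by move: H3; rewrite Hn Hd negbK.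
case: ifP => // /and3P[Hn H1 H2] [<-]; right; split=> // [Ha|m].
  by move: H; rewrite Ha (negbTE H2) /= andbF andbT => /negbFE.
have -> : 2 * n - j.+1 = (2 * n - 2 - j).+1 by lia.
apply: N_lower => //.
by have -> : (2 * n - 2 - j).+1 = 2 * n - 1 - j by lia.
Qed.

Lemma colf_adm j P P' : j < n -> colf n j P = Some P' -> adm P <-> adm P'.
Proof.
move=> Hj E; have [i1 i2 i3 i4] := N_incr P Hj.
have C := colf_cases Hj E.
have far m : m <> j.+1 -> m <> 2 * n - j.+1 -> N P m = N P' m.
  by move=> H1 H2; case: C => [[_ _ _ ->]|[_ _ _ ->]]; case: eqP => //; lia.
have far2 m : m <= n -> m <> j.+1 -> N P m = N P' m /\ N P (2 * n - m) = N P' (2 * n - m).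
  by move=> H1 H2; split; apply: far; lia.
have S := far (2 * n) ltac:(lia) ltac:(lia).
have f0 := far2 j ltac:(lia) ltac:(lia).
have f2 H := far2 j.+2 H ltac:(lia).
split=> H m Hm; have [->|Em] := eqVneq m j.+1;
  try by [have := far2 m Hm ltac:(lia); have := H m Hm; lia].
- have h0 := H j ltac:(lia); have h1 := H j.+1 ltac:(lia).
  case: C => [[c1 c2 c3 NP]|[c0 [c1 c1'] c3 NP]]; have n1 := NP j.+1; have n2 := NP (2 * n - j.+1).
    by lia.
  by have h2 := H j.+2 c0; lia.
- have h0 := H j ltac:(lia); have h1 := H j.+1 ltac:(lia).
  case: (ltnP j.+1 n) => Hn; last first.
    case: C => [[c1 c2 c3 NP]|[]]; last by lia.
    by have n1 := NP j.+1; have n2 := NP (2 * n - j.+1); lia.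
  have h2 := H j.+2 Hn; have f2' := f2 Hn.
  case: C => [[c1 c2 c3 NP]|[c0 [c1 c1'] c3 NP]]; have n1 := NP j.+1; have n2 := NP (2 * n - j.+1).
    by lia.
  by lia.
Qed.
End Tab.

Section Tab2.
Variable n : nat.
Implicit Types (P Q : pred nat) (j a m : nat).
Local Open Scope ring_scope.

(* In [tab], the indices m and m' separate: both inequalities compare a function
   of m' with the same function of m. *)
Definition gN P m : int := (N P m)%:Z - (N P (2 * n - m)%N)%:Z - m%:Z.
Definition hN P Q m : int := (N Q m)%:Z - (N P (2 * n - m)%N)%:Z - m%:Z.

Lemma tab_gh P Q : tab n P Q <->
  forall m m' : nat, (m <= m')%N -> (m' <= n)%N -> gN P m' <= hN P Q m /\ gN Q m' <= hN P Q m.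
Proof.
by rewrite /gN /hN; split=> H m m' Hm Hm'; have := H m m' Hm Hm'; lia.
Qed.

Lemma gh_step P Q j : (j < n)%N ->
  [/\ gN P j.+1 = gN P j + (P j)%:Z + (P (2 * n - 1 - j)%N)%:Z - 1 &
      hN P Q j.+1 = hN P Q j + (Q j)%:Z + (P (2 * n - 1 - j)%N)%:Z - 1].
Proof.
move=> Hj; have [i1 _ i3 _] := N_incr P Hj; have [k1 _ k3 _] := N_incr Q Hj.
by rewrite /gN /hN; split; lia.
Qed.

Lemma gh_step2 P Q j : (j.+1 < n)%N ->
  [/\ gN P j.+2 = gN P j.+1 + (P j.+1)%:Z + (P (2 * n - 2 - j)%N)%:Z - 1 &
      hN P Q j.+2 = hN P Q j.+1 + (Q j.+1)%:Z + (P (2 * n - 2 - j)%N)%:Z - 1].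
Proof.
move=> Hj; have := gh_step P Q Hj.
by have -> : (2 * n - 1 - j.+1 = 2 * n - 2 - j)%N by lia.
Qed.

Definition below (g1 g2 h : nat -> int) :=
  forall m m' : nat, (m <= m')%N -> (m' <= n)%N -> g1 m' <= h m /\ g2 m' <= h m.

(* Values at j, j+1, j+2 and new values at j+1. The new g is at most the maximum
   and the new h at least the minimum of the three old values, so only the
   inequality at m = m' = j+1 needs an argument of its own. *)
Definition local (x0 x1 x2 y0 y1 y2 h0 h1 h2 x1' y1' h1' : int) : Prop :=
  [/\ forall M : int, x0 <= M -> x1 <= M -> x2 <= M -> x1' <= M,
      forall M : int, y0 <= M -> y1 <= M -> y2 <= M -> y1' <= M,
      forall M : int, M <= h0 -> M <= h1 -> M <= h2 -> M <= h1'
    & x0 <= h0 /\ y0 <= h0 -> x1 <= h0 /\ y1 <= h0 -> x2 <= h0 /\ y2 <= h0 ->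
      x1 <= h1 /\ y1 <= h1 -> x2 <= h1 /\ y2 <= h1 -> x2 <= h2 /\ y2 <= h2 ->
      x1' <= h1' /\ y1' <= h1'].

Lemma below_transfer (gx gy h gx' gy' h' : nat -> int) j : (j.+1 < n)%N ->
  (forall m, (m <= n)%N -> m <> j.+1 -> [/\ gx' m = gx m, gy' m = gy m & h' m = h m]) ->
  local (gx j) (gx j.+1) (gx j.+2) (gy j) (gy j.+1) (gy j.+2) (h j) (h j.+1) (h j.+2)
    (gx' j.+1) (gy' j.+1) (h' j.+1) ->
  below gx gy h -> below gx' gy' h'.
Proof.
move=> Hj far [Gx Gy Hh Hd] H m m' Hm Hm'.
have L1 : (j <= n)%N by lia.
have L2 : (j.+1 <= n)%N by lia.
have [Em|/eqP Em] := eqVneq m j.+1; have [Em'|/eqP Em'] := eqVneq m' j.+1.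
- by subst m m'; apply: Hd; apply: H => //; clear; lia.
- have [-> -> _] := far m' Hm' Em'; subst m.
  have M2 : (j.+2 <= m')%N by clear -Hm Em'; lia.
  have [H0 K0] := H j m' (ltnW (ltnW M2)) Hm'; have [H1 K1] := H j.+1 m' (ltnW M2) Hm'.
  have [H2 K2] := H j.+2 m' M2 Hm'.
  by split; apply: Hh.
- have M2 : (m <= j)%N by clear -Hm Em Em'; lia.
  have [_ _ ->] := far m (leq_trans M2 L1) Em; subst m'.
  have [H0 K0] := H m j M2 L1; have [H1 K1] := H m j.+1 (leqW M2) L2.
  have [H2 K2] := H m j.+2 (leqW (leqW M2)) Hj.
  by split; [apply: Gx|apply: Gy].
- have [_ _ ->] := far m (leq_trans Hm Hm') Em; have [-> -> _] := far m' Hm' Em'.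
  exact: H.
Qed.

Lemma below_iff (gx gy h gx' gy' h' : nat -> int) j : (j.+1 < n)%N ->
  (forall m, (m <= n)%N -> m <> j.+1 -> [/\ gx' m = gx m, gy' m = gy m & h' m = h m]) ->
  (let L x y z := local (gx j) x (gx j.+2) (gy j) y (gy j.+2) (h j) z (h j.+2) in
   L (gx j.+1) (gy j.+1) (h j.+1) (gx' j.+1) (gy' j.+1) (h' j.+1) /\
   L (gx' j.+1) (gy' j.+1) (h' j.+1) (gx j.+1) (gy j.+1) (h j.+1)) ->
  below gx gy h <-> below gx' gy' h'.
Proof.
move=> Hj far [L1 L2]; split; apply: (below_transfer Hj) => //.
  by move=> m H1 H2; have [] := far m H1 H2.
have [-> -> ->] := far j (ltnW (ltnW Hj)) ltac:(clear; lia).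
by have [-> -> ->] := far j.+2 Hj ltac:(clear; lia).
Qed.

Lemma far_eq j (P P' : pred nat) m p : (j < n)%N -> (m <= n)%N -> m <> j.+1 ->
  p = j.+1 \/ p = (2 * n - j.+1)%N ->
  (forall k, N P k = N P' k + (k == p))%N ->
  N P m = N P' m /\ N P (2 * n - m)%N = N P' (2 * n - m)%N.
Proof.
move=> Hj Hm Em Hp NP; rewrite !NP.
have -> : (m == p) = false by apply/eqP; clear -Hj Hm Em Hp; lia.
have -> : ((2 * n - m)%N == p) = false by apply/eqP; clear -Hj Hm Em Hp; lia.
by rewrite !addn0.
Qed.

(** The inequality between [colep] and [colph] is the tensor product rule: f_j acts on the first
    factor of the word P Q. A tableau is read from right to left, so this factor is its right
    column. *)
Lemma tab_left j P P' Q : (j.+1 < n)%N -> colf n j P = Some P' ->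
  (colep n j Q < colph n j P)%N -> tab n P Q <-> tab n P' Q.
Proof.
move=> Hj E Hep; have Hj' : (j < n)%N by exact: ltnW.
rewrite !tab_gh -/(below _ _ _) -/(below _ _ _).
have [p1 h1] := gh_step P Q Hj'; have [p2 h2] := gh_step2 P Q Hj.
have [q1 _] := gh_step Q Q Hj'; have [q2 _] := gh_step2 Q Q Hj.
move: Hep; rewrite /colep /colph Hj /= => Hep.
have [[c1 c2 c3 NP]|[_ [c1 c2] c3 NP]] := colf_cases Hj' E;
  apply: (below_iff Hj) => /=.
- by move=> m Hm Em; rewrite /gN /hN; have [-> ->] := far_eq Hj' Hm Em (or_introl erefl) NP.
- have -> : gN P' j.+1 = gN P j.+1 - 1.
    by rewrite /gN !NP eqxx; case: eqP => /=; clear -Hj; lia.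
  have -> : hN P' Q j.+1 = hN P Q j.+1 by rewrite /hN !NP; case: eqP => /=; clear -Hj; lia.
  rewrite c1 (negbTE c2) /= in p1 p2 Hep; have {}c3 := c3 Hj.
  by clear -p1 p2 q1 q2 h1 h2 c3 Hep; split; split; lia.
- by move=> m Hm Em; rewrite /gN /hN; have [-> ->] := far_eq Hj' Hm Em (or_intror erefl) NP.
- have -> : gN P' j.+1 = gN P j.+1 + 1.
    by rewrite /gN !NP eqxx; case: eqP => /=; clear -Hj; lia.
  have -> : hN P' Q j.+1 = hN P Q j.+1 + 1.
    by rewrite /hN !NP eqxx; clear -Hj; lia.
  rewrite c1 (negbTE c2) /= in p1 p2 h1 h2 Hep.
  by clear -p1 p2 q1 q2 h1 h2 c3 Hep; split; split; lia.
Qed.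

Lemma tab_right j P Q Q' : (j.+1 < n)%N -> colf n j Q = Some Q' ->
  (colph n j P <= colep n j Q)%N -> tab n P Q <-> tab n P Q'.
Proof.
move=> Hj E Hep; have Hj' : (j < n)%N by exact: ltnW.
rewrite !tab_gh -/(below _ _ _) -/(below _ _ _).
have [p1 h1] := gh_step P Q Hj'; have [p2 h2] := gh_step2 P Q Hj.
have [q1 _] := gh_step Q Q Hj'; have [q2 _] := gh_step2 Q Q Hj.
move: Hep; rewrite /colep /colph Hj /= => Hep.
have [[c1 c2 c3 NP]|[_ [c1 c2] c3 NP]] := colf_cases Hj' E;
  apply: (below_iff Hj) => /=.
- by move=> m Hm Em; rewrite /gN /hN; have [-> ->] := far_eq Hj' Hm Em (or_introl erefl) NP.
- have -> : gN Q' j.+1 = gN Q j.+1 - 1.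
    by rewrite /gN !NP eqxx; case: eqP => /=; clear -Hj; lia.
  have -> : hN P Q' j.+1 = hN P Q j.+1 - 1 by rewrite /hN !NP eqxx; clear -Hj; lia.
  rewrite c1 (negbTE c2) /= in q1 q2 h1 h2 Hep; have {}c3 := c3 Hj.
  by clear -p1 p2 q1 q2 h1 h2 c3 Hep; split; split; lia.
- by move=> m Hm Em; rewrite /gN /hN; have [-> ->] := far_eq Hj' Hm Em (or_intror erefl) NP.
- have -> : gN Q' j.+1 = gN Q j.+1 + 1.
    by rewrite /gN !NP eqxx; case: eqP => /=; clear -Hj; lia.
  have -> : hN P Q' j.+1 = hN P Q j.+1.
    by rewrite /hN !NP; case: eqP => /=; clear -Hj; lia.
  rewrite c1 (negbTE c2) /= in q1 q2 Hep.
  by clear -p1 p2 q1 q2 h1 h2 c3 Hep; split; split; lia.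
Qed.

(** The operator f_n only changes counts at n, and there is no neighbour n+1 to compare with. For m
    < m' = n the changing terms occur on both sides and cancel, so the case m = m' = n is all that
    needs an argument. *)
Lemma tab_n P P' Q Q' :
  (forall m, (m < n)%N -> [/\ N P m = N P' m, N P (2 * n - m)%N = N P' (2 * n - m)%N,
     N Q m = N Q' m & N Q (2 * n - m)%N = N Q' (2 * n - m)%N]) ->
  (tab n P Q -> (N P' n <= N Q' n)%N) -> tab n P Q -> tab n P' Q'.
Proof.
move=> far Hd H m m' Hm Hm'; have [Em|Em] := eqVneq m' n; last first.
  have H1 : (m' < n)%N by clear -Hm' Em; lia.
  have [f1 f2 f3 f4] := far m (leq_ltn_trans Hm H1); have [g1 g2 g3 g4] := far m' H1.
  by have := H m m' Hm Hm'; rewrite ?f1 ?f2 ?f3 ?f4 ?g1 ?g2 ?g3 ?g4.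
have -> : (2 * n - m' = n)%N by rewrite Em mul2n -addnn addnK.
have Hn := H m m' Hm Hm'; subst m'.
have [Em'|Em'] := eqVneq m n.
  have -> : (2 * n - m = n)%N by rewrite Em' mul2n -addnn addnK.
  by subst m; have := Hd H; clear; lia.
have [f1 f2 f3 f4] := far m ltac:(clear -Hm Em'; lia).
move: Hn; have -> : (2 * n - n = n)%N by clear; lia.
by rewrite -?f1 -?f2 -?f3 -?f4; clear; lia.
Qed.

Lemma tab_left_n j P P' Q : j.+1 = n -> colf n j P = Some P' ->
  (colep n j Q < colph n j P)%N -> tab n P Q <-> tab n P' Q.
Proof.
move=> Hj E Hep; have Hj' : (j < n)%N by rewrite Hj.
have [i1 _ i3 _] := N_incr P Hj'; have [k1 _ k3 _] := N_incr Q Hj'.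
have e1 : (2 * n - j.+1 = n)%N by clear -Hj; lia.
have e2 : (2 * n - 1 - j = n)%N by clear -Hj; lia.
have e3 : (2 * n - 2 - j = j)%N by clear -Hj; lia.
move: Hep; rewrite /colep /colph e2 e3 Hj ltnn !andFb /= addn0 add0n andbT => Hep.
rewrite e1 e2 Hj in i1 i3 k1 k3.
have [[c1 c2 c3 NP]|[]] := colf_cases Hj' E; last by rewrite Hj ltnn.
rewrite Hj in c2 NP.
have far m : (m < n)%N -> N P m = N P' m /\ N P (2 * n - m)%N = N P' (2 * n - m)%N.
  move=> Hm; rewrite !NP (ltn_eqF Hm) gtn_eqF ?addn0 //.
  by clear -Hm; lia.
have np := NP n; rewrite eqxx in np.
split; apply: tab_n.
- by move=> m Hm; have [-> ->] := far m Hm.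
- by move=> H; have := H n n (leqnn _) (leqnn _); clear -np; lia.
- by move=> m Hm; have [-> ->] := far m Hm.
- move=> H; have H1 := H j n (ltnW Hj') (leqnn _); have H2 := H j j (leqnn _) (ltnW Hj').
  have [f1 f2] := far j Hj'; rewrite -f2 -f1 in H1 H2.
  move: H1; have -> : (2 * n - n = n)%N by clear; lia.
  move=> H1; clear far NP H E; lia.
Qed.

Lemma tab_right_n j P Q Q' : j.+1 = n -> colf n j Q = Some Q' ->
  (colph n j P <= colep n j Q)%N -> tab n P Q <-> tab n P Q'.
Proof.
move=> Hj E Hep; have Hj' : (j < n)%N by rewrite Hj.
have [i1 _ i3 _] := N_incr P Hj'; have [k1 _ k3 _] := N_incr Q Hj'.
have e1 : (2 * n - j.+1 = n)%N by clear -Hj; lia.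
have e2 : (2 * n - 1 - j = n)%N by clear -Hj; lia.
have e3 : (2 * n - 2 - j = j)%N by clear -Hj; lia.
move: Hep; rewrite /colep /colph e2 e3 Hj ltnn !andFb /= addn0 add0n andbT => Hep.
rewrite e1 e2 Hj in i1 i3 k1 k3.
have [[c1 c2 c3 NQ]|[]] := colf_cases Hj' E; last by rewrite Hj ltnn.
rewrite Hj in c2 NQ.
have far m : (m < n)%N -> N Q m = N Q' m /\ N Q (2 * n - m)%N = N Q' (2 * n - m)%N.
  move=> Hm; rewrite !NQ (ltn_eqF Hm) gtn_eqF ?addn0 //.
  by clear -Hm; lia.
have nq := NQ n; rewrite eqxx in nq.
split; apply: tab_n.
- by move=> m Hm; have [-> ->] := far m Hm.
- move=> H; have H1 := H j n (ltnW Hj') (leqnn _); have H2 := H j j (leqnn _) (ltnW Hj').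
  have H3 := H n n (leqnn _) (leqnn _).
  move: H1 H3; have -> : (2 * n - n = n)%N by clear; lia.
  move=> H1 H3; clear far NQ H E; lia.
- by move=> m Hm; have [-> ->] := far m Hm.
- by move=> H; have := H n n (leqnn _) (leqnn _); clear -nq; lia.
Qed.

Lemma tab_leftP j P P' Q : (j < n)%N -> colf n j P = Some P' ->
  (colep n j Q < colph n j P)%N -> tab n P Q <-> tab n P' Q.
Proof.
move=> Hj; case: (ltnP j.+1 n) => Hn; first exact: tab_left.
by apply: tab_left_n; apply/eqP; rewrite eqn_leq Hj Hn.
Qed.

Lemma tab_rightP j P Q Q' : (j < n)%N -> colf n j Q = Some Q' ->
  (colph n j P <= colep n j Q)%N -> tab n P Q <-> tab n P Q'.
Proof.
move=> Hj; case: (ltnP j.+1 n) => Hn; first exact: tab_right.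
by apply: tab_right_n; apply/eqP; rewrite eqn_leq Hj Hn.
Qed.
End Tab2.

(** * The greedy splitting of an admissible column *)

Section Greedy.
Variables (n : nat) (c : seq nat).
Definition is_free (t : nat) : bool := (t \notin c) && (bar n t \notin c).

Lemma filter_iota_last k t0 cs : [seq t <- iota 0 k | is_free t] = t0 :: cs ->
  let t := last t0 cs in [/\ is_free t, t < k & forall t', is_free t' -> t' < k -> t' <= t].
Proof.
move=> E /=; have Hin : last t0 cs \in [seq t <- iota 0 k | is_free t] by rewrite E mem_last.
move: (Hin); rewrite mem_filter mem_iota /= => /andP[H1 H2]; split=> // t' H3 H4.
have : t' \in t0 :: cs by rewrite -E mem_filter H3 mem_iota.
have : sorted leq (t0 :: cs).
  by rewrite -E; apply: (sorted_filter leq_trans); apply: iota_sorted.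
elim: cs t0 t' {E Hin H1 H2 H3 H4} => [|b cs IH] t0 t' /=; first by rewrite inE => _ /eqP ->.
case/andP=> H5 H6; rewrite inE => /orP[/eqP ->|]; last exact: IH.
by apply: leq_trans H5 (IH b b H6 (mem_head _ _)).
Qed.

Lemma gtn_sorted_lt x s : path gtn x s -> all (fun y => y < x) s.
Proof. by apply: order_path_min => a b d /= H1 H2; apply: ltn_trans H2 H1. Qed.

(** The last two clauses capture greediness: each t lies below its z, so above any bound there are
    no more ts than zs; and a free letter is skipped only if above it there are already as many ts
    as zs. *)
Lemma ts_of_Some zs prev r : sorted gtn zs -> all (predC is_free) zs ->
  ts_of n c zs prev = Some r ->
  [/\ size r = size zs, all is_free r, sorted gtn r, all (fun t => t < prev) r &
   (forall m, count (leq m) r <= count (leq m) zs) /\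
   (forall t, is_free t -> t < prev -> count (ltn t) r < count (ltn t) zs -> t \in r)].
Proof.
elim: zs prev r => [|z zs IH] prev r; first by move=> _ _ [<-].
move=> Hs /= /andP[Hz Hzs]; case E: [seq _ <- _ | _] => [|t0 cs] //.
have [F1 F2 F3] := filter_iota_last E; move: F1 F2 F3; set t := last t0 cs => F1 F2 F3.
case Er: (ts_of _ _ _ _) => [r'|] //= [<-].
have [I1 I2 I3 I4 [I5 I6]] := IH _ _ (path_sorted Hs) Hzs Er.
have ltz := gtn_sorted_lt Hs.
split.
- by rewrite /= I1.
- by rewrite /= F1 I2.
- rewrite /=; case: r' I3 I4 {Er I1 I2 I5 I6} => //= a r' -> /andP[-> _].
  by [].
- rewrite /=; have Htp : t < prev by move: F2; rewrite leq_min => /andP[].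
  by rewrite Htp; apply: sub_all I4 => a Ha; apply: ltn_trans Ha Htp.
- have Htz : t < z by move: F2; rewrite leq_min => /andP[].
  split=> [m /=|a Fa Ha /=].
    apply: leq_add (I5 m); case: (leqP m t) => //= Hm.
    by rewrite (leq_trans Hm (ltnW Htz)).
  rewrite inE; case: (ltngtP a t) => //= Hat.
  + have -> : a < z by apply: ltn_trans Hat Htz.
    by rewrite ltn_add2l; apply: I6.
  + have Haz : z <= a.
      by rewrite leqNgt; apply/negP => Haz; have := F3 a Fa; rewrite leq_min Ha Haz leqNgt Hat => /(_ isT).
    rewrite (ltnNge a z) Haz add0n.
    have -> : count (ltn a) zs = 0.
      apply/eqP; rewrite -leqn0 leqNgt -has_count; apply/hasPn => y /(allP ltz) /= Hy.
      by rewrite -leqNgt; apply: leq_trans (ltnW Hy) Haz.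
    by [].
Qed.

(** Failure produces a Hall-type obstruction. An obstruction [m] for the tail persists when m is at
    most the chosen t. Otherwise the tail has more elements than there are free letters below t;
    adding t on one side and z on the other gives the obstruction z+1. *)
Lemma ts_of_None zs prev : sorted gtn zs -> all (predC is_free) zs ->
  ts_of n c zs prev = None ->
  exists2 m, m <= (head 0 zs).+1 & count is_free (iota 0 (minn m prev)) < count (fun z => z < m) zs.
Proof.
elim: zs prev => [|z zs IH] prev // Hs /= /andP[Hz Hzs].
have ltz := gtn_sorted_lt Hs.
have cz : (z < z.+1) + count (fun y => y < z.+1) zs = (size zs).+1.
  rewrite ltnSn; have -> // : count (fun y => y < z.+1) zs = size zs.
  by apply/eqP; rewrite -all_count; apply: sub_all ltz => y; apply: ltnW.
have Fz (p : nat) : count is_free (iota 0 (minn z.+1 p)) = count is_free (iota 0 (minn p z)).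
  case: (ltnP z p) => Hzp; last first.
    by have -> : minn z.+1 p = p by clear -Hzp; lia.
  have -> : minn z.+1 p = z.+1 by clear -Hzp; lia.
  by rewrite -addn1 iotaD count_cat /= add0n (negbTE Hz) !addn0.
case E: [seq _ <- _ | _] => [|t0 cs].
  move=> _; exists z.+1 => //; rewrite cz Fz -size_filter.
  by rewrite /is_free E.
have [F1 F2 F3] := filter_iota_last E; move: F1 F2 F3; set t := last t0 cs => F1 F2 F3.
case Er: (ts_of _ _ _ _) => [r'|] //= _.
have [m Hm Hc] := IH _ (path_sorted Hs) Hzs Er.
have Htz : t < z by move: F2; rewrite leq_min => /andP[].
have Htp : t < prev by move: F2; rewrite leq_min => /andP[].
case: (leqP m t) => Hmt.
  exists m; first by apply: leq_trans Hmt (leqW (ltnW Htz)).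
  move: Hc; rewrite (minn_idPl Hmt) (minn_idPl (leq_trans Hmt (ltnW Htp))).
  by move=> Hc; apply: leq_trans Hc (leq_addl _ _).
exists z.+1 => //; rewrite cz Fz.
have -> : count is_free (iota 0 (minn prev z)) = (count is_free (iota 0 t)).+1.
  have Z : count is_free (iota t.+1 (minn prev z - t.+1)) = 0.
    apply/eqP; rewrite -leqn0 leqNgt -has_count; apply/hasPn => y.
    rewrite mem_iota => /andP[H1]; rewrite subnKC // => H2; apply/negP => /F3 /(_ H2).
    by rewrite leqNgt H1.
  rewrite -(subnKC (F2 : t.+1 <= _)) iotaD count_cat add0n Z addn0.
  by rewrite -addn1 iotaD count_cat /= add0n F1 addn0 addn1.
rewrite ltnS; move: Hc; rewrite (minn_idPr (ltnW Hmt)) => Hc.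
by apply: leq_trans Hc _; rewrite count_size.
Qed.
End Greedy.

Lemma count_mem_iota (s : seq nat) p : uniq s ->
  count (mem s) (iota 0 p) = count (fun x => x < p) s.
Proof.
move=> Us; elim: p => [|p IH]; first by elim: s {Us} => //= x s <-.
rewrite -addn1 iotaD count_cat IH /= add0n addn0 -(count_uniq_mem p Us).
rewrite -count_predUI; have -> : count (predI (fun x => x < p) (pred1 p)) s = 0.
  rewrite -(count_pred0 s); apply: eq_count => x /=; case: eqP => [->|]; rewrite ?ltnn ?andbF //.
by rewrite addn0; apply: eq_count => x /=; rewrite addn1 ltnS [in RHS]leq_eqVlt orbC.
Qed.

Lemma count_leq_split (s : seq nat) m : uniq s ->
  count (leq m) s = (m \in s) + count (leq m.+1) s.
Proof.
move=> Us; rewrite -(count_uniq_mem m Us) -count_predUI.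
have -> : count (predI (pred1 m) (leq m.+1)) s = 0.
  rewrite -(count_pred0 s); apply: eq_count => x /=; case: eqP => [->|]; rewrite ?ltnn //.
by rewrite addn0; apply: eq_count => x /=; rewrite leq_eqVlt eq_sym.
Qed.

Lemma count_lt_leq (s : seq nat) m : count (fun x => x < m) s + count (leq m) s = size s.
Proof.
rewrite -(count_predC (fun x => x < m)); congr addn; apply: eq_count => x /=.
by rewrite leqNgt.
Qed.

Lemma all_lt_count (s : seq nat) m : all (fun x => x < m) s -> count (leq m) s = 0.
Proof. by elim: s => //= x s IH /andP[Hx /IH ->]; rewrite leqNgt Hx. Qed.

Lemma N_add (A B C D : pred nat) p : (forall x, x < p -> A x + B x = C x + D x) ->
  N A p + N B p = N C p + N D p.
Proof.
elim: p => [|p IH] H; first by [].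
rewrite !N_S addnACA IH; last by move=> x Hx; apply: H; apply: ltnW.
by rewrite H // addnACA.
Qed.

Lemma N_diff_le (A B : pred nat) m m' : m <= m' ->
  (forall x, m <= x -> x < m' -> A x -> B x) -> N A m' + N B m <= N A m + N B m'.
Proof.
move=> Hm; rewrite -(subnKC Hm); elim: (m' - m) => [|d IH] H; first by rewrite addn0.
have {}IH : N A (m + d) + N B m <= N A m + N B (m + d).
  by apply: IH => x H1 H2; apply: H => //; rewrite addnS ltnS ltnW.
have := H (m + d) (leq_addr _ _); rewrite addnS !N_S ltnSn => /(_ isT).
by move: IH; case: (A _); case: (B _); clear; lia.
Qed.

Lemma sorted_nth_count (s : seq nat) k p : sorted ltn s -> k < size s ->
  (nth 0 s k < p) = (k < count (fun x => x < p) s).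
Proof.
elim: s k => [|a s IH] k //= Hs Hk.
have Ha : all (fun y => a < y) s by apply: order_path_min Hs => x y z; apply: ltn_trans.
have Hs' := path_sorted Hs.
case: (ltnP a p) => Hap.
  by case: k Hk => [|k] Hk //=; rewrite IH.
have C0 : count (fun x => x < p) s = 0.
  apply/eqP; rewrite -leqn0 leqNgt -has_count; apply/hasPn => y /(allP Ha) Hy.
  by rewrite -leqNgt (leq_trans Hap) // ltnW.
rewrite C0 /=; case: k Hk => [|k] Hk /=; first by rewrite ltnNge Hap.
by rewrite IH // C0.
Qed.

(** * The split form in terms of counting functions *)

Section Split.
Variable n : nat.
Implicit Types (P Q A B : pred nat) (m p k : nat).

(** In an increasing column, entry k is below p exactly when more than k entries are. Rowwise
    comparison therefore becomes domination of counting functions. *)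
Lemma rows_counts A B : N B (2 * n) <= N A (2 * n) ->
  (forall k, k < N B (2 * n) -> nth 0 (colP n A) k <= nth 0 (colP n B) k) <->
  (forall p, p <= 2 * n -> N B p <= N A p).
Proof.
move=> Hs; have sA k p : k < N A (2 * n) -> p <= 2 * n -> (nth 0 (colP n A) k < p) = (k < N A p).
  by move=> Hk Hp; rewrite sorted_nth_count ?sorted_colP ?size_colP // N_colP.
have sB k p : k < N B (2 * n) -> p <= 2 * n -> (nth 0 (colP n B) k < p) = (k < N B p).
  by move=> Hk Hp; rewrite sorted_nth_count ?sorted_colP ?size_colP // N_colP.
have mono C p q : p <= q -> N C p <= N C q.
  by move=> Hpq; rewrite /N -(subnKC Hpq) iotaD count_cat leq_addr.
split=> H.
- move=> p Hp; rewrite leqNgt; apply/negP => Hlt.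
  have HB : N A p < N B (2 * n) by apply: leq_trans Hlt (mono _ _ _ Hp).
  have := H _ HB; rewrite leqNgt => /negP; apply.
  have H1 : nth 0 (colP n B) (N A p) < p by rewrite sB.
  apply: leq_trans H1 _; rewrite leqNgt sA ?ltnn //; exact: leq_trans HB Hs.
- move=> k Hk; have Hn : nth 0 (colP n B) k < 2 * n.
    by apply: (allP (colP_lt n B)); apply: mem_nth; rewrite size_colP.
  rewrite -ltnS sA ?(leq_trans Hk Hs) //; apply: leq_trans (H _ Hn).
  by rewrite -sB.
Qed.

Variable P : pred nat.
Let c := colP n P.
Let zs := zs_of n c.
Let r := ts n c.
Definition both z := P z && P (bar n z).
Definition free z := ~~ P z && ~~ P (bar n z).

Lemma bar_lt z : z < n -> bar n z < 2 * n. Proof. by rewrite /bar; clear; lia. Qed.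

Lemma bar_ge z : z < n -> n <= bar n z. Proof. by rewrite /bar; clear; lia. Qed.

Lemma mem_zs z : (z \in zs) = (z < n) && both z.
Proof.
rewrite /zs /zs_of mem_rev mem_filter mem_iota /= !mem_colP.
case: (ltnP z n) => Hz; rewrite ?andbF ?andbT //= bar_lt // andbT.
have -> : z < 2 * n by [clear -Hz; lia]; rewrite andbT /both ?andbT //.
Qed.

Lemma frE t : t < n -> is_free n c t = free t.
Proof.
move=> Ht; rewrite /is_free !mem_colP bar_lt // andbT.
by have -> : t < 2 * n by [clear -Ht; lia]; rewrite andbT.
Qed.

Lemma zs_sorted : sorted gtn zs.
Proof. by rewrite /zs /zs_of rev_sorted; apply: sorted_filter (iota_ltn_sorted _ _); apply: ltn_trans. Qed.

Lemma uniq_gtn (s : seq nat) : sorted gtn s -> uniq s.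
Proof. by apply: sorted_uniq => [x y z /= H1 H2|x]; [apply: ltn_trans H2 H1|apply: ltnn]. Qed.

Lemma zs_is_free : all (predC (is_free n c)) zs.
Proof.
apply/allP => z; rewrite mem_zs => /andP[Hz Hb] /=; rewrite frE //.
by move: Hb; rewrite /both /free => /andP[-> _].
Qed.

Lemma count_zs m : m <= n -> count (fun z => z < m) zs = N both m.
Proof.
move=> Hm; rewrite -count_mem_iota ?uniq_gtn ?zs_sorted //.
by apply: eq_in_count => z; rewrite mem_iota /= mem_zs => /(fun H => leq_trans H Hm) ->.
Qed.

(** Counts the letters in the m pairs formed by z < m and its bar: one for each pair, one more if
    both letters are present, one less if neither is. *)
Lemma balance m : m <= n ->
  N P m + N P (2 * n) + N free m = N P (2 * n - m) + m + N both m.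
Proof.
elim: m => [|m IH] Hm; first by rewrite subn0 /N /= !addn0 add0n.
have {IH} := IH (ltnW Hm); rewrite !N_S /both /free.
have -> : N P (2 * n - m) = N P (2 * n - m.+1) + P (bar n m).
  have -> : bar n m = 2 * n - m.+1 by rewrite /bar; clear; lia.
  by rewrite -N_S; congr N; clear -Hm; lia.
by case: (P m); case: (P (bar n m)) => /=; clear; lia.
Qed.

Lemma is_free_free m : m <= n -> count (is_free n c) (iota 0 m) = N free m.
Proof.
move=> Hm; apply: eq_in_count => t; rewrite mem_iota /= => Ht; apply: frE.
exact: leq_trans Ht Hm.
Qed.

(** By [balance], [adm] is Hall's condition: below each m there are at least as many free letters as
    full pairs. A successful splitting implies it since the ts are free and lie below their zs;
    [ts_of_None] gives the converse. *)
Lemma ts_isSome : isSome (ts_of n c zs n) <-> adm n P.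
Proof.
case E: (ts_of n c zs n) => [s|]; split=> // H.
- have [I1 I2 I3 I4 [I5 I6]] := ts_of_Some zs_sorted zs_is_free E => m Hm.
  have Us := uniq_gtn I3.
  have K : N both m <= N free m.
    rewrite -count_zs //; apply: (@leq_trans (count (fun t => t < m) s)).
      by have := count_lt_leq zs m; have := count_lt_leq s m; have := I5 m; rewrite I1; clear; lia.
    rewrite -is_free_free // -count_mem_iota //.
    by apply: sub_count => t; apply: (allP I2).
  by have := balance Hm; clear -K; lia.
- have [m Hm Hc] := ts_of_None zs_sorted zs_is_free E.
  have Hmn : m <= n.
    case Ez: zs Hm Hc => [|z zs'] // Hm _; apply: leq_trans Hm _.
    by have := mem_zs z; rewrite Ez inE eqxx /= => /esym/andP[].
  move: Hc; rewrite (minn_idPl Hmn) is_free_free // count_zs // => Hc.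
  by have := H m Hmn; have := balance Hmn; clear -Hc; lia.
Qed.

Lemma zs_lt : all (fun z => z < n) zs.
Proof. by apply/allP => z; rewrite mem_zs => /andP[]. Qed.

Hypothesis Padm : adm n P.

Lemma tsP : [/\ size r = size zs, all (is_free n c) r, sorted gtn r, all (fun t => t < n) r &
   (forall m, count (leq m) r <= count (leq m) zs) /\
   (forall t, is_free n c t -> t < n -> count (ltn t) r < count (ltn t) zs -> t \in r)].
Proof.
rewrite /r /ts -/zs; case: (ts_of _ _ _ _) (proj2 ts_isSome Padm) (@ts_of_Some n c zs n) => [s|] // _.
by apply; [exact: zs_sorted|exact: zs_is_free|].
Qed.

Lemma deficit_ge m m' : m <= m' -> m' <= n ->
  N both m' + count (leq m) r + N free m <= N free m' + count (leq m) zs + N both m.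
Proof.
move=> Hm Hm'; have [I1 I2 I3 I4 [I5 I6]] := tsP; have Hmn := leq_trans Hm Hm'.
have Ur := uniq_gtn I3.
have := count_lt_leq zs m; have := count_lt_leq zs m'; rewrite !count_zs //.
have := count_lt_leq r m; have := count_lt_leq r m'; have := I5 m'.
have : N (mem r) m' + N free m <= N (mem r) m + N free m'.
  apply: N_diff_le => // x _ Hx Hr; rewrite -frE ?(leq_trans Hx) //.
  exact: (allP I2).
by rewrite /N !count_mem_iota // -!/(N _ _); clear; lia.
Qed.

(** Induction downwards from n, where the deficit is zero. A zero deficit is attained at m' = m. If
    the deficit at k is positive, greediness forces a free k to be among the ts, so passing from k+1
    to k changes the deficit exactly as it changes #pairs - #free, and the m' found for k+1 still
    serves. *)
Lemma deficit_attained m : m <= n -> exists m', [/\ m <= m', m' <= n &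
  N both m' + count (leq m) r + N free m = N free m' + count (leq m) zs + N both m].
Proof.
have [I1 I2 I3 I4 [I5 I6]] := tsP; have Ur := uniq_gtn I3; have Uz := uniq_gtn zs_sorted.
move=> Hm; rewrite -(subKn Hm); have : n - m <= n by apply: leq_subr.
elim: (n - m) => [_|d IH Hd].
  rewrite subn0; exists n; split=> //.
  by rewrite (all_lt_count I4) (all_lt_count zs_lt); clear; lia.
set k := n - d.+1; have Ek : n - d = k.+1 by rewrite /k; clear -Hd; lia.
have [m' [H1 H2 H3]] := IH (ltnW Hd); rewrite Ek in H1 H2 H3.
have [E|E] := eqVneq (count (leq k) r) (count (leq k) zs).
  exists k; split=> //; first by rewrite leq_subr.
  by rewrite E; clear; lia.
exists m'; split=> //; first exact: ltnW.
have Hk : k < n by rewrite /k; clear -Hd; lia.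
move: H3 E (I5 k) (I5 k.+1) (I6 k); rewrite !N_S !(count_leq_split k) // mem_zs Hk /= frE //.
rewrite -[count (ltn k) r]/(count (leq k.+1) r) -[count (ltn k) zs]/(count (leq k.+1) zs).
have : k \in r -> free k by move=> Hr; rewrite -frE //; apply: (allP I2).
have : free k -> ~~ both k by rewrite /both /free => /andP[/negbTE->].
case: (free k) => [/(_ isT)/negbTE -> _|_]; last first.
  by case: (k \in r) => [/(_ isT)//|_] /=; clear; lia.
case: (k \in r) => /=; first by clear; lia.
move=> H3 E L1 L2 /(_ isT isT) L3.
case: (ltngtP (count (leq k.+1) r) (count (leq k.+1) zs)) L3 => [_ /(_ isT)//|L4 _|L4 _].
  by move: L2; rewrite leqNgt L4.
by move: E; rewrite L4 eqxx.
Qed.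

Lemma deficit_le m M :
  m <= n -> (forall m', m <= m' -> m' <= n -> N both m' + N free m <= N free m' + N both m + M) <->
  count (leq m) zs <= count (leq m) r + M.
Proof.
move=> Hm; split=> H.
  by have [m' [H1 H2 H3]] := deficit_attained Hm; have := H m' H1 H2; clear -H3; lia.
by move=> m' H1 H2; have := deficit_ge H1 H2; clear -H; lia.
Qed.

Definition lpred x := ((x \in c) && (x \notin zs)) || (x \in r).
Definition rpred x := ((x \in c) && (x \notin map (bar n) zs)) || (x \in map (bar n) r).

Lemma N_lpred p : p <= 2 * n ->
  N lpred p + count (fun x => x < p) zs = N P p + count (fun x => x < p) r.
Proof.
have [I1 I2 I3 I4 _] := tsP; have Ur := uniq_gtn I3; have Uz := uniq_gtn zs_sorted.
move=> Hp; rewrite -!count_mem_iota //; apply: N_add => x Hx.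
have cx : (x \in c) = P x by rewrite mem_colP (leq_trans Hx Hp) andbT.
have zx : x \in zs -> P x by rewrite mem_zs => /andP[_ /andP[]].
have rx : x \in r -> ~~ P x.
  by move=> Hr; have := allP I2 _ Hr; rewrite frE ?(allP I4) // => /andP[].
rewrite /lpred cx /=.
by move/implyP: zx; move/implyP: rx; case: (P x); case: (x \in zs); case: (x \in r).
Qed.

Lemma bar_inj_lt s : all (fun x => x < n) s -> {in s &, injective (bar n)}.
Proof. by move=> Hs x y /(allP Hs) Hx /(allP Hs) Hy; rewrite /bar; clear -Hx Hy; lia. Qed.

Lemma N_rpred p : p <= 2 * n ->
  N rpred p + count (fun x => x < p) (map (bar n) zs) =
  N P p + count (fun x => x < p) (map (bar n) r).
Proof.
have [I1 I2 I3 I4 _] := tsP; have Ur := uniq_gtn I3; have Uz := uniq_gtn zs_sorted.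
have Ur' : uniq (map (bar n) r) by rewrite map_inj_in_uniq //; apply: bar_inj_lt.
have Uz' : uniq (map (bar n) zs) by rewrite map_inj_in_uniq //; apply: bar_inj_lt zs_lt.
move=> Hp; rewrite -!count_mem_iota //; apply: N_add => x Hx.
have cx : (x \in c) = P x by rewrite mem_colP (leq_trans Hx Hp) andbT.
have zx : x \in map (bar n) zs -> P x.
  by case/mapP => z; rewrite mem_zs => /andP[_ /andP[_ H]] ->.
have rx : x \in map (bar n) r -> ~~ P x.
  by case/mapP => z Hr ->; have := allP I2 _ Hr; rewrite frE ?(allP I4) // => /andP[].
rewrite /rpred cx /=.
by move/implyP: zx; move/implyP: rx; case: (P x); case: (x \in map _ zs); case: (x \in map _ r).
Qed.

Lemma count_map_bar s m : all (fun x => x < n) s -> m <= n ->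
  count (fun x => x < 2 * n - m) (map (bar n) s) = count (leq m) s.
Proof.
move=> Hs Hm; rewrite count_map; apply: eq_in_count => x /(allP Hs) Hx /=.
by rewrite /bar; clear -Hx Hm; lia.
Qed.

Lemma count_lt_all s p : all (fun x => x < n) s -> n <= p -> count (fun x => x < p) s = size s.
Proof.
by move=> Hs Hp; apply/eqP; rewrite -all_count; apply: sub_all Hs => x Hx; apply: leq_trans Hx Hp.
Qed.

(** Splitting moves letters of lc within the unbarred half and letters of rc within the barred half.
    On its other half each has the counts of the column itself; on this half they differ by the
    deficit. *)
Lemma N_lpred_lo m : m <= n -> N lpred m + count (leq m) r = N P m + count (leq m) zs.
Proof.
move=> Hm; have [I1 _ _ _ _] := tsP.
have := N_lpred (p := m) ltac:(lia); have := count_lt_leq zs m; have := count_lt_leq r m.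
by rewrite I1; clear; lia.
Qed.

Lemma N_lpred_hi m : m <= n -> N lpred (2 * n - m) = N P (2 * n - m).
Proof.
move=> Hm; have [I1 _ _ I4 _] := tsP.
have := N_lpred (p := 2 * n - m) ltac:(lia).
by rewrite !count_lt_all ?zs_lt ?I1 //; [clear|clear -Hm|clear -Hm]; lia.
Qed.

Lemma N_rpred_hi m : m <= n ->
  N rpred (2 * n - m) + count (leq m) zs = N P (2 * n - m) + count (leq m) r.
Proof.
move=> Hm; have [I1 _ _ I4 _] := tsP.
have := N_rpred (p := 2 * n - m) ltac:(lia).
by rewrite !count_map_bar // zs_lt.
Qed.

Lemma N_rpred_lo m : m <= n -> N rpred m = N P m.
Proof.
move=> Hm; have [I1 _ _ I4 _] := tsP.
have := N_rpred (p := m) ltac:(lia).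
have Z s : all (fun x => x < n) s -> count (fun x => x < m) (map (bar n) s) = 0.
  move=> Hs; rewrite count_map -(count_pred0 s); apply: eq_in_count => x /(allP Hs) Hx /=.
  by rewrite /bar; clear -Hx Hm; lia.
by rewrite !Z ?zs_lt // !addn0.
Qed.

End Split.

Section ColleTab.
Variables (n : nat) (P Q : pred nat).
Hypotheses (Padm : adm n P) (Qadm : adm n Q).

(** For p = m <= n the split changes only the counts of P, and the deficit of P gives the first
    inequality of [tab]; for p = 2n-m it changes only those of Q, and the deficit of Q gives the
    second. The index m' runs over the candidates for the maximum. *)
Lemma colle_tab : colle n (colP n Q) (colP n P) <-> tab n P Q.
Proof.
have S1 : size (colP n P) = N (lpred n P) (2 * n).
  by rewrite size_colP; have := N_lpred_hi Padm (leq0n n); rewrite subn0.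
have S2 : size (colP n Q) = N (rpred n Q) (2 * n).
  rewrite size_colP; have := N_rpred_hi Qadm (leq0n n); rewrite subn0.
  have [I1 _ _ _ _] := tsP Qadm.
  have e0 s : count (leq 0) s = size s by apply/eqP; rewrite -all_count; apply/allP.
  by rewrite !e0 I1 => /addIn.
have E : colle n (colP n Q) (colP n P) <->
    forall p, p <= 2 * n -> N (lpred n P) p <= N (rpred n Q) p.
  rewrite /colle; split.
    case/andP; rewrite S1 S2 => Hs /allP H; apply/(rows_counts Hs) => k Hk.
    by apply: H; rewrite mem_iota.
  move=> H; have Hs := H _ (leqnn _); rewrite S1 S2 Hs /=.
  by apply/allP => k; rewrite mem_iota /= => Hk; apply: (proj2 (rows_counts Hs)).
rewrite E; split=> H.
- move=> m m' Hm Hm'; have Hmn := leq_trans Hm Hm'.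
  have b1 := balance P Hmn; have b2 := balance P Hm'.
  have c1 := balance Q Hmn; have c2 := balance Q Hm'.
  split.
    have Hl := H m ltac:(lia); have := N_lpred_lo Padm Hmn; rewrite (N_rpred_lo Qadm Hmn) in Hl.
    have := deficit_ge Padm Hm Hm'.
    by clear -b1 b2 Hl Hm; lia.
  have Hl := H (2 * n - m) ltac:(lia); have := N_rpred_hi Qadm Hmn; rewrite (N_lpred_hi Padm Hmn) in Hl.
  have := deficit_ge Qadm Hm Hm'.
  by clear -c1 c2 Hl Hm; lia.
- move=> p Hp; case: (leqP p n) => Hpn.
    have K : count (leq p) (zs_of n (colP n P)) <= count (leq p) (ts n (colP n P)) + (N Q p - N P p).
      apply/(deficit_le Padm _ Hpn) => m' H1 H2; have [G1 _] := H p m' H1 H2.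
      have [G2 _] := H p p (leqnn _) Hpn.
      have b1 := balance P Hpn; have b2 := balance P H2.
      by clear -G1 G2 b1 b2 H1; lia.
    have [G2 _] := H p p (leqnn _) Hpn.
    have := N_lpred_lo Padm Hpn; rewrite (N_rpred_lo Qadm Hpn); clear -K G2; lia.
  have [m Hm ->] : exists2 m, m <= n & p = 2 * n - m by exists (2 * n - p); clear -Hp Hpn; lia.
  have K : count (leq m) (zs_of n (colP n Q)) <= count (leq m) (ts n (colP n Q)) + (N Q (2 * n - m) - N P (2 * n - m)).
    apply/(deficit_le Qadm _ Hm) => m' H1 H2; have [_ G1] := H m m' H1 H2.
    have [_ G2] := H m m (leqnn _) Hm.
    have b1 := balance Q Hm; have b2 := balance Q H2.
    by clear -G1 G2 b1 b2 H1; lia.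
  have [_ G2] := H m m (leqnn _) Hm.
  have := N_rpred_hi Qadm Hm; rewrite (N_lpred_hi Padm Hm); clear -K G2; lia.
Qed.
End ColleTab.

(** * Words of admissible columns *)

Section ACol.
Variable n : nat.
Implicit Types (P Q : pred nat) (j m : nat) (c : seq nat) (a b : acol) (w : seq acol).

Lemma N_ext P Q m : colP n P = colP n Q -> m <= 2 * n -> N P m = N Q m.
Proof. by move=> E Hm; rewrite -!(N_colP (n := n)) // E. Qed.

Lemma adm_ext P Q : colP n P = colP n Q -> adm n P -> adm n Q.
Proof.
move=> E H m Hm; have := H m Hm.
by rewrite !(N_ext E) //; clear -Hm; lia.
Qed.

Definition acolumn c := exists2 P, c = colP n P & adm n P.

Lemma admissibleP c : admissible n c <-> acolumn c /\ c <> [::].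
Proof.
split=> [/andP[/and3P[/eqP H1 H2 H3] H4]|[[P -> HP] H0]].
  split=> //; exists (mem c); first exact: colP_mem.
  by apply/ts_isSome; rewrite -colP_mem.
rewrite /admissible /is_col sorted_colP colP_lt !andbT.
by apply/andP; split; [apply/eqP|apply/ts_isSome].
Qed.

Lemma acolumn_nil : acolumn [::].
Proof.
exists pred0; first by rewrite /colP filter_pred0.
have N0 m : N pred0 m = 0 by rewrite /N count_pred0.
by move=> m _; rewrite !N0.
Qed.

Lemma isAColP a : isACol n a <-> acolumn (odflt [::] a) /\ a <> Some [::].
Proof.
case: a => [c|] /=; last by split=> // _; split=> //; exact: acolumn_nil.
by rewrite admissibleP; split=> -[H1 H2]; split=> //; [case|move=> E; rewrite E in H2].
Qed.

Lemma aprecP a b P Q : isACol n a -> isACol n b ->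
  odflt [::] a = colP n P -> odflt [::] b = colP n Q -> adm n P -> adm n Q ->
  aprec n b a <-> tab n P Q.
Proof.
move=> /isAColP[_ Ha] /isAColP[_ Hb] EP EQ HP HQ.
have mono C p q : p <= q -> N C p <= N C q.
  by move=> Hpq; rewrite /N -(subnKC Hpq) iotaD count_cat leq_addr.
case: a Ha EP => [x|] Ha /= EP; last first.
  have NP m : m <= 2 * n -> N P m = 0 by move=> Hm; rewrite -(N_colP _ Hm) -EP.
  split=> [_ m m' Hm Hm'|_]; last by case: (b).
  rewrite !NP; try (clear -Hm Hm'; lia).
  have : N Q m' + N pred0 m <= N Q m + N predT m'.
    have : N Q m' + N predT m <= N Q m + N predT m' by apply: N_diff_le.
    by rewrite /N count_pred0 !count_predT !size_iota; clear; lia.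
  have : N Q m' + m <= N Q m + m'.
    have : N Q m' + N predT m <= N Q m + N predT m' by apply: N_diff_le.
    by rewrite /N !count_predT !size_iota.
  by clear -Hm; lia.
case: b Hb EQ => [y|] Hb /= EQ; first by rewrite EP EQ; apply: colle_tab.
(* At m = m' = 0 the second inequality compares the lengths of the columns, so a nonempty one cannot
   stand to the right of epsilon. *)
split=> // H; have [_] := H 0 0 (leqnn _) (leq0n _).
have NQ : N Q (2 * n) = 0 by rewrite -(N_colP _ (leqnn _)) -EQ.
rewrite !subn0 NQ /= -size_colP -EP.
by case: x Ha {EP H} => // Ha; case: Ha.
Qed.

Lemma acolumn_fL j c c' : j < n -> fL n j c = Some c' -> acolumn c <-> acolumn c'.
Proof.
move=> Hj E; have K P : c = colP n P -> exists2 P', c' = colP n P' & colf n j P = Some P'.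
  move=> Ec; have [_ _ EP _] := colP_stat P Hj; move: E; rewrite Ec EP.
  by case: (colf n j P) => [P'|] // [<-]; exists P'.
split=> [[P Ec HP]|[P' Ec' HP']].
  have [P' Ec' EP] := K P Ec; exists P' => //; exact/(colf_adm Hj EP).
have [_ _ _ EP] := colP_stat P' Hj; move/(fL_eL _ _ Hj): (E); rewrite Ec' EP.
case: (cole n j P') => [P|] // [Ec]; exists P => //.
have [P'' Ec'' EP''] := K P (esym Ec); apply/(colf_adm Hj EP'').
by apply: adm_ext HP'; rewrite -Ec'.
Qed.

Definition shp w := [seq omap size a | a <- w].

Lemma pw_cons a w : pw (a :: w) = odflt [::] a ++ pw w.
Proof. by []. Qed.

Lemma regroup_cons a w c s : size c = size (odflt [::] a) ->
  regroup (a :: w) (c ++ s) = (if a is Some _ then Some c else None) :: regroup w s.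
Proof.
by move=> E; rewrite /regroup /= take_size_cat // drop_size_cat //; case: a E.
Qed.

Lemma regroup_pw w w' : shp w = shp w' -> regroup w (pw w') = w'.
Proof.
elim: w w' => [|a w IH] [|a' w'] //= [E Es]; rewrite pw_cons regroup_cons.
  by rewrite IH //; case: a a' E => [c|] [c'|].
by case: a a' E => [c|] [c'|] //= [].
Qed.

Lemma regroupK w s : size s = size (pw w) -> pw (regroup w s) = s /\ shp (regroup w s) = shp w.
Proof.
elim: w s => [|a w IH] s; first by case: s.
rewrite pw_cons size_cat => Es; rewrite -(cat_take_drop (size (odflt [::] a)) s).
have St : size (take (size (odflt [::] a)) s) = size (odflt [::] a).
  by rewrite size_takel // Es leq_addr.
have [|E1 E2] := IH (drop (size (odflt [::] a)) s).
  by rewrite size_drop Es addnC addnK.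
rewrite regroup_cons // pw_cons E1 /= E2; case: a St {Es E1 E2} => [c|] /= St; first by rewrite St.
by rewrite take0.
Qed.

Lemma fA_Some j w w' : fA n j w = Some w' <-> fL n j (pw w) = Some (pw w') /\ shp w = shp w'.
Proof.
rewrite /fA; split.
  case E: (fL n j (pw w)) => [s|] // [<-]; have [-> ->] := regroupK (fL_sz E).
  by [].
by case=> -> Es /=; rewrite regroup_pw.
Qed.

Lemma fA_None j w : fA n j w = None <-> fL n j (pw w) = None.
Proof. by rewrite /fA; case: (fL n j (pw w)). Qed.

Lemma eL_fA j w s : j < n -> eL n j (pw w) = Some s ->
  exists2 w', pw w' = s & fA n j w' = Some w.
Proof.
move=> Hj /(fL_eL _ _ Hj) E; have Es : size s = size (pw w) by rewrite (fL_sz E).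
have [E1 E2] := regroupK Es; exists (regroup w s) => //.
by apply/fA_Some; rewrite E1.
Qed.

Lemma fA_cat j w1 w2 : fA n j (w1 ++ w2) =
  if ep (sgnL n j) (pw w2) < ph (sgnL n j) (pw w1) then omap (cat^~ w2) (fA n j w1)
  else omap (cat w1) (fA n j w2).
Proof.
have pwc u v : pw (u ++ v) = pw u ++ pw v by rewrite /pw map_cat flatten_cat.
have E : fL n j (pw (w1 ++ w2)) = if ep (sgnL n j) (pw w2) < ph (sgnL n j) (pw w1)
    then omap (cat^~ (pw w2)) (fL n j (pw w1)) else omap (cat (pw w1)) (fL n j (pw w2)).
  by rewrite pwc !fLE fG_cat.
move: E; case: ifP => _ E.
  case E1: (fA n j w1) => [w1'|] /=.
    move/fA_Some: E1 => [E1 Es]; apply/fA_Some; rewrite E E1 pwc /=; split=> //.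
    by rewrite /shp !map_cat -/(shp _) Es.
  by move/fA_None: E1 => E1; apply/fA_None; rewrite E E1.
case E1: (fA n j w2) => [w2'|] /=.
  move/fA_Some: E1 => [E1 Es]; apply/fA_Some; rewrite E E1 pwc /=; split=> //.
  by rewrite /shp !map_cat -/(shp w2) -/(shp w2') Es.
by move/fA_None: E1 => E1; apply/fA_None; rewrite E E1.
Qed.

Lemma fA1 j a w' : j < n -> fA n j [:: a] = Some w' ->
  exists2 a', w' = [:: a'] & fL n j (odflt [::] a) = Some (odflt [::] a') /\
    (isACol n a <-> isACol n a').
Proof.
move=> Hj /fA_Some; rewrite /pw /= cats0 => -[]; case: w' => [|a' [|]] // E [Es].
rewrite /= cats0 in E; exists a' => //; split=> //; rewrite !isAColP (acolumn_fL Hj E).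
have S0 := fL_sz E; have Z x : x <> Some [::] <-> ~~ (isSome x && (size (odflt [::] x) == 0)).
  by case: x => [[|z x]|].
by rewrite !Z S0; case: a a' Es {E S0 Z} => [x|] [y|].
Qed.

Lemma fA_ACol j w w' : j < n -> fA n j w = Some w' ->
  all (isACol n) w <-> all (isACol n) w'.
Proof.
move=> Hj; elim: w w' => [|a w IH] w' // E.
have := fA_cat j [:: a] w; rewrite /= {}E; case: ifP => _.
  case E: (fA n j [:: a]) => [v|] // [->]; have [a' -> [_ Ha]] := fA1 Hj E.
  by rewrite /=; split=> /andP[/Ha H1 H2]; rewrite /= H1 H2.
case E: (fA n j w) => [v|] // [->]; have Hw := IH _ E.
by rewrite /=; split=> /andP[H1 /Hw H2]; rewrite /= H1 H2.
Qed.

Lemma fA_pair j a b w' : j < n -> isACol n a -> isACol n b -> fA n j [:: a; b] = Some w' ->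
  exists a' b', [/\ w' = [:: a'; b'], isACol n a', isACol n b' & aprec n b a = aprec n b' a'].
Proof.
move=> Hj Ha Hb E.
have /fA_Some [_] := E; case: w' E => [|a' [|b' [|]]] // E [_ _].
have /andP[Ha' /andP[Hb' _]] : all (isACol n) [:: a'; b'].
  by apply/(fA_ACol Hj E); rewrite /= Ha Hb.
exists a', b'; split=> //.
have [[P EP HP] _] := proj1 (isAColP a) Ha; have [[Q EQ HQ] _] := proj1 (isAColP b) Hb.
have := fA_cat j [:: a] [:: b]; rewrite [LHS]E /pw /= !cats0 EP EQ.
have [_ p1 p2 _] := colP_stat P Hj; have [q1 _ q2 _] := colP_stat Q Hj.
rewrite p1 q1; case: ltnP => Hpq.
  case Ea: (fA n j [:: a]) => [v|] // [Ev]; have [a1 Ea1 [Fa _]] := fA1 Hj Ea.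
  rewrite Ea1 in Ev; case: Ev => ? ?; subst a1 b'.
  move: Fa; rewrite EP p2; case EP': (colf n j P) => [P'|] // [Ea'].
  apply/idP/idP.
    move/(aprecP Ha Hb EP EQ HP HQ)/(tab_leftP Hj EP' Hpq) => T.
    by apply/(aprecP Ha' Hb (esym Ea') EQ); rewrite // -?(colf_adm Hj EP').
  move/(aprecP Ha' Hb (esym Ea') EQ (proj1 (colf_adm Hj EP') HP) HQ)/(tab_leftP Hj EP' Hpq) => T.
  exact/(aprecP Ha Hb EP EQ).
case Eb: (fA n j [:: b]) => [v|] // [Ev E2]; have [b1 Eb1 [Fb _]] := fA1 Hj Eb.
rewrite Eb1 in E2; case: E2 => ?; subst a' b1.
move: Fb; rewrite EQ q2; case EQ': (colf n j Q) => [Q'|] // [Eb'].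
apply/idP/idP.
  move/(aprecP Ha Hb EP EQ HP HQ)/(tab_rightP Hj EQ' Hpq) => T.
  by apply/(aprecP Ha Hb' EP (esym Eb')); rewrite // -?(colf_adm Hj EQ').
move/(aprecP Ha Hb' EP (esym Eb') HP (proj1 (colf_adm Hj EQ') HQ))/(tab_rightP Hj EQ' Hpq) => T.
exact/(aprecP Ha Hb EP EQ).
Qed.

End ACol.

(** * Tableaux in plactic classes *)

Section Plac.
Variable n : nat.
Implicit Types (u v w c : seq nat) (j : nat) (P Q : pred nat).

Lemma plac_sub u v u' v' phi : connL n u u' -> connL n v v' -> phi u' = v' ->
  (forall x, connL n u x -> wtL n (phi x) = wtL n x /\
     (forall j, j < n -> fL n j (phi x) = omap phi (fL n j x) /\ eL n j (phi x) = omap phi (eL n j x))) ->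
  (forall x y, connL n u x -> connL n u y -> phi x = phi y -> x = y) ->
  (forall y, connL n v y -> exists2 x, connL n u x & phi x = y) -> plac n u' v'.
Proof.
move=> Cu Cv E H1 H2 H3; have T x : connL n u' x -> connL n u x by apply: rst_trans.
exists phi; split=> //.
- by move=> x /T; apply: H1.
- by move=> x y /T Hx /T Hy; apply: H2.
- move=> y Hy; have [x Hx Ex] := H3 y (rst_trans _ _ _ _ _ Cv Hy).
  by exists x => //; apply: rst_trans (rst_sym _ _ _ _ Cu) Hx.
Qed.

Lemma plac_step j u v : j < n -> plac n u v ->
  opt_rel (plac n) (fL n j u) (fL n j v) /\ opt_rel (plac n) (eL n j u) (eL n j v).
Proof.
move=> Hj [phi [E H1 H2 H3]].
have [_ /(_ j Hj)] := H1 u (rst_refl _ _ u); rewrite E => -[F G]; rewrite F G; split.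
  case Eu: (fL n j u) => [u'|] //=.
  apply: (plac_sub (phi := phi) _ _ _ H1 H2 H3) => //; apply: rst_step; exists j => //.
  by rewrite F Eu.
case Eu: (eL n j u) => [u'|] //=.
apply: (plac_sub (phi := phi) _ _ _ H1 H2 H3) => //; apply: rst_sym; apply: rst_step; exists j => //;
  by apply/fL_eL => //; rewrite G Eu.
Qed.

Lemma plac_wt u v : plac n u v -> wtL n u = wtL n v.
Proof. by case=> phi [E H1 _ _]; have [<- _] := H1 u (rst_refl _ _ u); rewrite E. Qed.

Lemma sgn_dnP j : j < n -> forall a, sgnL n j a = Some true ->
  sgnL n j a.+1 = Some false /\ a.+1.-1 = a.
Proof. by move=> Hj a /(sgn_plus Hj) []. Qed.

(** Phi is the number of times f_j can be applied, and each application is carried along the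
    isomorphism. *)
Lemma plac_ph j u v : j < n -> plac n u v -> ph (sgnL n j) u = ph (sgnL n j) v.
Proof.
move=> Hj; move Em: (ph (sgnL n j) u) => m; elim: m u v Em => [|m IH] u v Em Huv.
  have /(fG_None _ succn) Fu := Em; have [] := plac_step Hj Huv; rewrite fLE Fu.
  by case Fv: (fL n j v) => //= _ _; move: Fv; rewrite fLE => /fG_None.
have [] := plac_step Hj Huv.
case Fu: (fL n j u) => [u'|]; last by move: Fu; rewrite fLE => /fG_None; rewrite Em.
case Fv: (fL n j v) => [v'|] //= Huv' _; move: Fu Fv; rewrite !fLE => Fu Fv.
have pu := fG_ph (sgn_dnP Hj) Fu; have pv := fG_ph (sgn_dnP Hj) Fv.
by rewrite pv -(IH u' v') //; move: pu; rewrite Em => -[].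
Qed.

Lemma plac_ep j u v : j < n -> plac n u v -> ep (sgnL n j) u = ep (sgnL n j) v.
Proof.
move=> Hj; move Em: (ep (sgnL n j) u) => m; elim: m u v Em => [|m IH] u v Em Huv.
  have /(eG_None _ predn) Fu := Em; have [_] := plac_step Hj Huv; rewrite eLE Fu.
  by case Fv: (eL n j v) => //= _; move: Fv; rewrite eLE => /eG_None.
have [_] := plac_step Hj Huv.
case Fu: (eL n j u) => [u'|]; last by move: Fu; rewrite eLE => /eG_None; rewrite Em.
case Fv: (eL n j v) => [v'|] //= Huv'; move/(fL_eL _ _ Hj): Fu; move/(fL_eL _ _ Hj): Fv.
rewrite !fLE => Fv Fu; have pu := fG_ep (sgn_dnP Hj) Fu; have pv := fG_ep (sgn_dnP Hj) Fv.
by rewrite pv -(IH u' v') //; move: pu; rewrite Em => -[].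
Qed.

Lemma down_closed (D : pred nat) k : (forall z, z.+1 < k -> D z.+1 -> D z) ->
  exists2 a, a <= k & forall z, z < k -> D z = (z < a).
Proof.
elim: k => [|k IH] H; first by exists 0.
have [|a Ha Ea] := IH; first by move=> z Hz; apply: H; apply: ltnW.
case Dk: (D k); last first.
  exists a; first exact: leqW.
  move=> z; rewrite ltnS leq_eqVlt => /orP[/eqP ->|]; last exact: Ea.
  by rewrite Dk ltnNge Ha.
exists k.+1 => // z Hz; rewrite Hz.
have {Dk} : D k by []. move: Hz; rewrite ltnS => Hz.
have : forall d, d <= k -> D k -> D (k - d).
  elim=> [|d IHd] Hd Dk; first by rewrite subn0.
  have E : (k - d.+1).+1 = k - d by clear -Hd; lia.
  by apply: H; rewrite E ?IHd ?(ltnW Hd) // ltnS leq_subr.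
by move=> /(_ (k - z) (leq_subr _ _)) H' /H'; rewrite subKn.
Qed.

Lemma colP_iota P a : a <= n -> (forall z, z < 2 * n -> P z = (z < a)) -> colP n P = iota 0 a.
Proof.
move=> Ha HP; apply: (irr_sorted_eq ltn_trans ltnn); rewrite ?sorted_colP ?iota_ltn_sorted //.
move=> x; rewrite mem_colP mem_iota /=; case: (ltnP x (2 * n)) => Hx; first by rewrite andbT HP.
by rewrite andbF; apply/esym/negbTE; rewrite -leqNgt; clear -Hx Ha; lia.
Qed.

(** Each letter of P that carries a - needs a + before it. For an unbarred q this forces q-1 into P,
    and so on down. A barred letter, say the bar of j, would force all of 0 .. j into P, and then
    [adm] fails at j+1. The hypothesis on [u] covers the case where the + comes from a preceding
    column. *)
Lemma highest_column u P : adm n P -> (forall j, j < n -> ep (sgnL n j) (u ++ colP n P) = 0) ->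
  (forall z, z \in u -> z < n /\ forall y, y <= z -> P y) ->
  exists2 a, a <= n & colP n P = iota 0 a.
Proof.
move=> HP He Hu.
have key q : q < 2 * n -> P q -> q < n /\ forall y, y <= q -> P y.
  elim/ltn_ind: q => q IH Hq Pq.
  case: (posnP q) => [Eq|q0].
    subst q; split; first by clear -Hq; lia.
    by move=> y; rewrite leqn0 => /eqP ->.
  have Ec : colP n P = seg P 0 q ++ q :: seg P q.+1 (2 * n - q.+1).
    rewrite /colP -/(seg P 0 (2 * n)) -{1}(subnKC (ltnW Hq)) seg_cat add0n; congr cat.
    have -> : 2 * n - q = (2 * n - q.+1).+1 by clear -Hq; lia.
    by rewrite /seg /= Pq.
  have prev j : j < n -> sgnL n j q = Some false ->
      exists2 y, sgnL n j y = Some true & (y \in u) \/ (y < q /\ P y).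
    move=> Hj Sq; have := He j Hj; rewrite Ec catA => E0; have /hasP [y] := ep0_prefix E0 Sq.
    rewrite mem_cat mem_filter mem_iota /= add0n => Hy /eqP Sy; exists y => //.
    by case/orP: Hy => [|/andP[H1 H2]]; [left|right].
  have plus j y : sgnL n j y = Some true -> y = j \/ y = 2 * n - 2 - j.
    by rewrite /sgnL; case: ifP => [/orP[/eqP ->|/eqP ->] _|_]; [left|right|case: ifP].
  case: (ltnP q n) => Hqn.
    split=> // y; rewrite leq_eqVlt => /orP[/eqP -> //|Hy].
    have Hj : q.-1 < n by clear -Hqn; lia.
    have Sq : sgnL n q.-1 q = Some false.
      rewrite /sgnL; case: ifP => [|_]; first by clear -Hqn q0; lia.
      by case: ifP => //; clear -Hqn q0; lia.
    have [z /plus Sz Hz] := prev _ Hj Sq.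
    have Pq1 : P q.-1.
      case: Hz => [/Hu [Hz1 Hz2]|[Hz1 Hz2]]; case: Sz => Ez; subst z.
      - exact: Hz2.
      - by exfalso; clear -Hz1 Hqn q0; lia.
      - by [].
      - by exfalso; clear -Hz1 Hqn q0; lia.
    have [_] := IH q.-1 ltac:(clear -q0; lia) ltac:(clear -Hq; lia) Pq1.
    by apply; clear -Hy; lia.
  exfalso; set j := 2 * n - 1 - q.
  have Hj : j < n by rewrite /j; clear -Hqn Hq; lia.
  have Sq : sgnL n j q = Some false.
    rewrite /sgnL /j; case: ifP => [|_]; first by clear -Hqn Hq; lia.
    by case: ifP => //; clear -Hqn Hq; lia.
  have [z /plus Sz Hz] := prev _ Hj Sq.
  have Pj : forall y, y <= j -> P y.
    case: Hz => [/Hu [Hz1 Hz2]|[Hz1 Hz2]]; case: Sz => Ez; subst z.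
    - exact: Hz2.
    - by move=> y Hy; apply: Hz2; move: Hz1 Hy; rewrite /j; clear -Hqn Hq; lia.
    - exact: (IH j Hz1 ltac:(clear -Hj; lia) Hz2).2.
    - have [H1 H2] := IH _ Hz1 ltac:(clear -Hj; lia) Hz2.
      by move=> y Hy; apply: H2; move: H1 Hy; rewrite /j; clear -Hqn Hq; lia.
  have N1 : N P j.+1 = j.+1.
    rewrite /N -{2}(size_iota 0 j.+1); apply/eqP; rewrite -all_count; apply/allP => y.
    by rewrite mem_iota => /andP[_]; apply: Pj.
  have N2 : N P (2 * n - j.+1) < N P (2 * n).
    have Eq : 2 * n - j.+1 = q by rewrite /j; clear -Hq; lia.
    have : N P q.+1 <= N P (2 * n).
      by rewrite /N -(subnKC (Hq : q.+1 <= _)) iotaD count_cat leq_addr.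
    by rewrite N_S Eq Pq addn1.
  by have := HP j.+1 Hj; rewrite N1; move: N2; clear; lia.
have [a Ha Ea] := @down_closed P n (fun z Hz Pz => (key z.+1 ltac:(clear -Hz; lia) Pz).2 z (leqnSn z)).
exists a => //; apply: colP_iota => // z Hz; case: (ltnP z n) => Hzn; first exact: Ea.
have -> : (z < a) = false by apply/negbTE; rewrite -leqNgt (leq_trans Ha).
by apply/negP => /(key z Hz) [] ; rewrite ltnNge Hzn.
Qed.

Definition iA k : acol := if k == 0 then None else Some (iota 0 k).

Lemma iAE (a : acol) k : isACol n a -> odflt [::] a = iota 0 k -> a = iA k.
Proof.
move=> /isAColP [_ Ha]; case: a Ha => [c|] Ha /=; last by case: k.
by move=> Ec; subst c; rewrite /iA; case: k Ha => //= Ha; case: Ha.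
Qed.

Lemma highest_tableau (a b : acol) : isACol n a -> isACol n b -> aprec n b a ->
  (forall j, j < n -> eL n j (pw [:: a; b]) = None) ->
  exists p q, [/\ p <= q, q <= n, a = iA p & b = iA q].
Proof.
move=> Ha Hb Hab He.
have [[P EP HP] _] := proj1 (isAColP n a) Ha; have [[Q EQ HQ] _] := proj1 (isAColP n b) Hb.
have T := proj1 (aprecP Ha Hb EP EQ HP HQ) Hab.
have Ep j : j < n -> ep (sgnL n j) (colP n P ++ colP n Q) = 0.
  by move=> /He; rewrite eLE /pw /= cats0 EP EQ => /eG_None.
have [||p Hp Fp] := @highest_column [::] P HP; [|by []|].
  move=> j /Ep; rewrite ep_cat /=; case: (ep _ (colP n P)) => //.
have NP m : m <= n -> N P m = minn m p.
  move=> Hm; rewrite -(N_colP (n := n)) ?Fp; last by clear -Hm; lia.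
  by rewrite -count_mem_iota ?iota_uniq //; elim: m {Hm} => [|m IH]; [rewrite min0n|
     rewrite -addn1 iotaD count_cat IH /= mem_iota /= add0n; clear; lia].
have Qp : forall y, y < p -> Q y.
  (* At m = m' = p the first inequality says that Q has at least p letters below p, hence all of
     them. *)
  have [H1 _] := T p p (leqnn _) Hp; move=> y Hy.
  have NQ : p <= N Q p by move: H1; rewrite (NP p Hp) minnn; clear; lia.
  have : N Q p == p by rewrite eqn_leq NQ andbT -{2}(size_iota 0 p) count_size.
  rewrite /N -{2}(size_iota 0 p) -all_count => /allP; apply.
  by rewrite mem_iota.
have [|q Hq Fq] := @highest_column (colP n P) Q HQ Ep.
  move=> z; rewrite Fp mem_iota /= => Hz; split; first exact: leq_trans Hz Hp.
  by move=> y Hy; apply: Qp; apply: leq_ltn_trans Hy Hz.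
exists p, q; split=> //; last 2 first.
- by apply: iAE => //; rewrite EP.
- by apply: iAE => //; rewrite EQ.
case: p Hp Fp NP Qp => // p Hp _ _ Qp.
have : p \in colP n Q by rewrite mem_colP Qp //=; clear -Hp; lia.
by rewrite Fq mem_iota.
Qed.
End Plac.

(** * Existence and uniqueness of the tableau of two columns *)

Section Insertion.
Variable n : nat.
Implicit Types (u v w c : seq nat) (j : nat) (P Q : pred nat) (a b x y : acol).

Definition tableau x y := [/\ isACol n x, isACol n y & aprec n y x].

Lemma pair_e j a b s : j < n -> isACol n a -> isACol n b -> eL n j (pw [:: a; b]) = Some s ->
  exists a' b', [/\ pw [:: a'; b'] = s, isACol n a', isACol n b',
    aprec n b' a' = aprec n b a & fA n j [:: a'; b'] = Some [:: a; b]].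
Proof.
move=> Hj Ha Hb /(eL_fA Hj) [w' Ew Ef].
have /fA_Some [_] := Ef; case: w' Ew Ef => [|a' [|b' [|]]] // Ew Ef [_ _].
have /andP[Ha' /andP[Hb' _]] : all (isACol n) [:: a'; b'].
  by apply/(fA_ACol Hj Ef); rewrite /= Ha Hb.
exists a', b'; split=> //.
by have [a1 [b1 [[-> ->] _ _ ->]]] := fA_pair Hj Ha' Hb' Ef.
Qed.

Lemma tableau_e j a b s : j < n -> tableau a b -> eL n j (pw [:: a; b]) = Some s ->
  exists a' b', [/\ pw [:: a'; b'] = s, tableau a' b' & fA n j [:: a'; b'] = Some [:: a; b]].
Proof.
move=> Hj [Ha Hb Hab] /(pair_e Hj Ha Hb) [a' [b' [H1 H2 H3 H4 H5]]].
by exists a', b'; split=> //; split=> //; rewrite H4.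
Qed.

Lemma sumn_eL j w s : j < n -> eL n j w = Some s -> sumn s < sumn w.
Proof.
move=> Hj /(fL_eL _ _ Hj); rewrite fLE; elim: s w => [|z s IH] w //=.
case: ifP => _; first by case=> <- /=.
by case E: (fG _ _ s) => [s'|] // [<-] /=; rewrite ltn_add2l; apply: IH.
Qed.

Lemma count_iota z k : count_mem z (iota 0 k) = (z < k).
Proof. by rewrite count_uniq_mem ?iota_uniq // mem_iota. Qed.

Lemma pw_iA p q : pw [:: iA p; iA q] = iota 0 p ++ iota 0 q.
Proof. by rewrite /pw /iA; case: p q => [|p] [|q]; rewrite /= ?cats0. Qed.

(** Both tableaux climb by the same e_j, with the sum of the letters as measure, and f_j recovers
    them. At the top, coordinate z of the weight is the number of columns longer than z, which fixes
    the two lengths up to order; p <= q fixes the order. *)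
Lemma tableau_inj v a b a' b' : tableau a b -> tableau a' b' ->
  plac n (pw [:: a; b]) v -> plac n (pw [:: a'; b']) v -> (a, b) = (a', b').
Proof.
have [k] := ubnP (sumn (pw [:: a; b])); elim: k a b a' b' v => // k IH a b a' b' v Hk T T' H H'.
have [[j [Hj He]]|Hno] := classic (exists j, j < n /\ eL n j (pw [:: a; b]) <> None).
  case E: (eL n j (pw [:: a; b])) He => [s|] // _.
  have [_] := plac_step Hj H; have [_] := plac_step Hj H'; rewrite E.
  case E': (eL n j (pw [:: a'; b'])) => [s'|]; last by case: (eL n j v).
  case: (eL n j v) => [v1|] //= Hs' Hs.
  have [x [y [Ex Txy Fxy]]] := tableau_e Hj T E.
  have [x' [y' [Ex' Txy' Fxy']]] := tableau_e Hj T' E'.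
  have [] : (x, y) = (x', y').
    apply: (IH _ _ _ _ v1) => //; rewrite ?Ex ?Ex' //.
    by apply: leq_trans (sumn_eL Hj E) _.
  by move=> ? ?; subst x' y'; move: Fxy'; rewrite Fxy => -[-> ->].
have He j : j < n -> eL n j (pw [:: a; b]) = None.
  by move=> Hj; case E: (eL n j _) => [s|] //; case: Hno; exists j; rewrite E.
have He' j : j < n -> eL n j (pw [:: a'; b']) = None.
  move=> Hj; move: (He j Hj); rewrite !eLE => /eG_None E; apply/eG_None.
  by rewrite (plac_ep Hj H') -(plac_ep Hj H).
case: T T' => [Ha Hb Hab] [Ha' Hb' Hab'].
have [p [q [Hpq Hq Ep Eq]]] := highest_tableau Ha Hb Hab He.
have [p' [q' [Hpq' Hq' Ep' Eq']]] := highest_tableau Ha' Hb' Hab' He'.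
have := plac_wt H; rewrite -(plac_wt H') Ep Eq Ep' Eq' !pw_iA => /eq_in_map W.
have {}W z : z < n -> (z < p) + (z < q) = (z < p') + (z < q').
  move=> Hz; have := W z; rewrite mem_iota => /(_ Hz); rewrite !count_cat !count_iota.
  have B r : r <= n -> (bar n z < r) = false.
    by move=> Hr; apply/negbTE; rewrite -leqNgt (leq_trans Hr) // bar_ge.
  by rewrite !B ?(leq_trans Hpq) ?(leq_trans Hpq') //; clear; lia.
have [-> ->] // : p = p' /\ q = q'.
have W1 := W p; have W2 := W p'; have W3 := W q; have W4 := W q'.
by clear -Hpq Hq Hpq' Hq' W1 W2 W3 W4; lia.
Qed.

Lemma isACol_iA k : k <= n -> isACol n (iA k).
Proof.
move=> Hk; apply/isAColP; split; last by rewrite /iA; case: (k).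
have -> : odflt [::] (iA k) = iota 0 k by rewrite /iA; case: (k).
have EN m : N (fun z => z < k) m = minn m k.
  by elim: m => [|m IH]; [rewrite min0n|rewrite N_S IH; clear; lia].
exists (fun z => z < k); first by rewrite (colP_iota (a := k)).
by move=> m Hm; rewrite !EN; clear -Hm Hk; lia.
Qed.

Lemma tableau_iA p q : p <= q -> q <= n -> tableau (iA p) (iA q).
Proof.
move=> Hpq Hq; have Hp := leq_trans Hpq Hq; split; try exact: isACol_iA.
have EN k m : N (fun z => z < k) m = minn m k.
  by elim: m => [|m IH]; [rewrite min0n|rewrite N_S IH; clear; lia].
have Ek k : k <= n -> odflt [::] (iA k) = colP n (fun z => z < k).
  by move=> Hk; rewrite (colP_iota (a := k)) // /iA; case: (k).
apply/(aprecP (isACol_iA Hp) (isACol_iA Hq) (Ek _ Hp) (Ek _ Hq)).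
- by move=> m Hm; rewrite !EN; clear -Hm Hp; lia.
- by move=> m Hm; rewrite !EN; clear -Hm Hq; lia.
- by move=> m m' Hm Hm'; rewrite !EN; clear -Hm Hm' Hpq Hq; split; lia.
Qed.

Lemma highest_iota p q j : p <= n -> q <= n -> j < n -> eL n j (iota 0 p ++ iota 0 q) = None.
Proof.
move=> Hp Hq Hj; rewrite eLE; apply/eG_None; rewrite ep_cat.
have E k : k <= n -> ep (sgnL n j) (iota 0 k) = 0.
  move=> Hk; rewrite -(colP_iota (n := n) (P := fun z => z < k)) //.
  have [-> _ _ _] := colP_stat (n := n) (fun z => z < k) Hj; rewrite /colep.
  by clear -Hk Hj; lia.
by rewrite !E.
Qed.

Lemma ph_ep_count (sg : nat -> option bool) w :
  ph sg w + count (fun z => sg z == Some false) w = ep sg w + count (fun z => sg z == Some true) w.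
Proof.
elim: w => //= z w IH; case: (sg z) => [[]|] //=; last by rewrite add0n; lia.
  by case: (ep sg w) IH => [|e] /=; lia.
Qed.

Lemma count_sgn j s w (b : bool) (p q : nat) : j < n -> p != q ->
  (forall z, (sgnL n j z == Some b) = (z == p) || (z == q)) ->
  s = count (fun z => sgnL n j z == Some b) w -> s = count_mem p w + count_mem q w.
Proof.
move=> Hj Hpq H ->; rewrite -count_predUI.
have -> : count (predI (pred1 p) (pred1 q)) w = 0.
  elim: w => //= z w ->; case: (z =P p) => // ->; by rewrite (negbTE Hpq).
by rewrite addn0; apply: eq_count => z /=; rewrite H.
Qed.

Lemma sign_eq : (((Some true == Some false) = false) * ((Some false == Some true) = false)) *
  ((None == Some true) = false) * ((None == Some false) = false).
Proof. by []. Qed.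

(** Phi minus epsilon is the number of + minus the number of -, the pairing of the weight with a
    simple coroot. With epsilon zero this makes the weight weakly decreasing, with nonnegative last
    coordinate. *)
Lemma dominant w : (forall j, j < n -> eL n j w = None) -> forall j, j < n ->
  count_mem j w + (if j.+1 < n then count_mem (bar n j.+1) w else 0) >=
  count_mem (bar n j) w + (if j.+1 < n then count_mem j.+1 w else 0).
Proof.
move=> He j Hj; have := He j Hj; rewrite eLE => /eG_None E.
have := ph_ep_count (sgnL n j) w; rewrite E add0n.
case: (ltnP j.+1 n) => Hn.
  rewrite (count_sgn (b := true) (p := j) (q := bar n j.+1) Hj _ _ erefl).
  - rewrite (count_sgn (b := false) (p := j.+1) (q := bar n j) Hj _ _ erefl).
    + by clear; lia.
    + by rewrite /bar; clear -Hn; lia.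
    + by clear -Hn; move=> z; rewrite /sgnL /bar; do 2?[case: ifP => ?]; rewrite ?sign_eq ?eqxx; lia.
  - by rewrite /bar; clear -Hn; lia.
  - by clear -Hn; move=> z; rewrite /sgnL /bar; do 2?[case: ifP => ?]; rewrite ?sign_eq ?eqxx; lia.
have -> : count (fun z => sgnL n j z == Some true) w = count_mem j w.
  by apply: eq_count; clear -Hn Hj; move=> z; rewrite /sgnL /=; do 2?[case: ifP => ?]; rewrite ?sign_eq ?eqxx; lia.
have -> : count (fun z => sgnL n j z == Some false) w = count_mem (bar n j) w.
  by apply: eq_count; clear -Hn Hj; move=> z; rewrite /sgnL /bar /=; do 2?[case: ifP => ?]; rewrite ?sign_eq ?eqxx; lia.
by clear; lia.
Qed.

Lemma ins_exists a b : isACol n a -> isACol n b -> exists xy, ins_spec n a b xy.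
Proof.
have [k] := ubnP (sumn (pw [:: a; b])); elim: k a b => // k IH a b Hk Ha Hb.
have [[j [Hj He]]|Hno] := classic (exists j, j < n /\ eL n j (pw [:: a; b]) <> None).
  case E: (eL n j (pw [:: a; b])) He => [s|] // _.
  have [a' [b' [Es Ha' Hb' _ Ef]]] := pair_e Hj Ha Hb E.
  have [|[x y] [/= Hx Hy Hxy Hp]] := IH a' b' _ Ha' Hb'.
    by rewrite Es; apply: leq_trans (sumn_eL Hj E) _.
  (* The tableau found for the e_j image is carried back by f_j, which preserves the tableau
     condition. *)
  have [+ _] := plac_step Hj Hp.
  move/fA_Some: (Ef) => [-> _]; case Fx: (fL n j (pw [:: x; y])) => [s'|] //= Hs.
  case Fxy: (fA n j [:: x; y]) => [w|]; last by move/fA_None: Fxy; rewrite Fx.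
  have [x' [y' [Ew Hx' Hy' Hxy']]] := fA_pair Hj Hx Hy Fxy.
  exists (x', y'); split=> //=; first by rewrite -Hxy'.
  by move/fA_Some: Fxy => [+ _]; rewrite Fx Ew => -[<-].
have He j : j < n -> eL n j (pw [:: a; b]) = None.
  by move=> Hj; case E: (eL n j _) => [s|] //; case: Hno; exists j; rewrite E.
have [[P EP HP] _] := proj1 (isAColP n a) Ha; have [[Q EQ HQ] _] := proj1 (isAColP n b) Hb.
have Ew : pw [:: a; b] = colP n P ++ colP n Q by rewrite /pw /= cats0 EP EQ.
rewrite Ew in He *; set w := colP n P ++ colP n Q in He *.
have Cl R z : count_mem z (colP n R) <= 1.
  rewrite count_uniq_mem ?leq_b1 // (sorted_uniq ltn_trans ltnn) //; exact: sorted_colP.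
have Cw z : count_mem z w <= 2 by rewrite count_cat; apply: (leq_add (n1 := 1)).
have D := dominant He.
(* The inequality in natural numbers says that a coordinate of the weight is at least i. *)
have dec i z : z.+1 < n -> count_mem (bar n z.+1) w + i <= count_mem z.+1 w ->
    count_mem (bar n z) w + i <= count_mem z w.
  by move=> Hz; have := D z (ltnW Hz); rewrite Hz; clear; lia.
have pos z : z < n -> count_mem (bar n z) w <= count_mem z w.
  move=> Hz; rewrite -(subKn (ltnW Hz)); have : n - z <= n by apply: leq_subr.
  have : 0 < n - z by rewrite subn_gt0.
  elim: (n - z) => // -[|d] IHd _ Hd.
    have := D (n - 1) ltac:(clear -Hd; lia).
    have -> : (n - 1).+1 = n by clear -Hd; lia.
    by rewrite ltnn !addn0.
  have En : (n - d.+2).+1 = n - d.+1 by clear -Hd; lia.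
  have := dec 0 (n - d.+2); rewrite En !addn0; apply; first by clear -Hd; lia.
  by apply: IHd => //; apply: ltnW.
(* The weight is a partition with parts at most 2, since a column contains each letter at most once.
   Its numbers of parts at least 1 and at least 2 are the column lengths q and p. *)
have [q Hq Eq] := @down_closed (fun z => count_mem (bar n z) w + 1 <= count_mem z w) n (dec 1).
have [p Hp Ep] := @down_closed (fun z => count_mem (bar n z) w + 2 <= count_mem z w) n (dec 2).
have Hpq : p <= q.
  case: p Hp Ep => // p Hp Ep; have := Ep p Hp; rewrite ltnSn => H.
  by rewrite -(Eq p Hp); move: H; clear; lia.
exists (iA p, iA q); have [T1 T2 T3] := tableau_iA Hpq Hq; split=> //=.
rewrite Ew pw_iA; apply: plac_highest => //.
- rewrite /letters all_cat; apply/andP; split; apply/allP => z; rewrite mem_iota /=;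
  by [clear -Hp; lia|clear -Hq; lia].
- by rewrite /letters all_cat !colP_lt.
- by move=> j Hj; apply: highest_iota.
apply/eq_in_map => z; rewrite mem_iota => /andP[_ Hz]; rewrite !count_cat !count_iota.
have B r : r <= n -> (bar n z < r) = false.
  by move=> Hr; apply/negbTE; rewrite -leqNgt (leq_trans Hr) // bar_ge.
rewrite !B // -!count_cat -/w -(Ep z Hz) -(Eq z Hz).
have := pos z Hz; have := Cw z; clear; lia.
Qed.

Lemma insP a b : isACol n a -> isACol n b -> ins_spec n a b (ins n a b).
Proof. by move=> Ha Hb; apply: epsilon_spec; apply: ins_exists. Qed.

(** As [ins] is chosen arbitrarily, equivariance has to come from uniqueness: f_j of the tableau for
    (a, b) is a tableau plactic equivalent to (a', b'), hence the one chosen there. *)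
Lemma ins_fA j a b a' b' : j < n -> isACol n a -> isACol n b ->
  fA n j [:: a; b] = Some [:: a'; b'] ->
  fA n j [:: (ins n a b).1; (ins n a b).2] = Some [:: (ins n a' b').1; (ins n a' b').2].
Proof.
move=> Hj Ha Hb E; have [Hx Hy Hxy Hp] := insP Ha Hb.
have [a1 [b1 [[<- <-] Ha' Hb' _]]] := fA_pair Hj Ha Hb E.
move: Hx Hy Hxy Hp; case: (ins n a b) => x y /= Hx Hy Hxy Hp.
have [+ _] := plac_step Hj Hp.
move/fA_Some: (E) => [-> _]; case Fx: (fL n j (pw [:: x; y])) => [s'|] //= Hs.
case Fxy: (fA n j [:: x; y]) => [w|]; last by move/fA_None: Fxy; rewrite Fx.
have [x' [y' [Ew Hx' Hy' Hxy']]] := fA_pair Hj Hx Hy Fxy.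
have [Hx1 Hy1 Hxy1 Hp1] := insP Ha' Hb'.
rewrite Ew; case: (ins n a' b') Hx1 Hy1 Hxy1 Hp1 => x1 y1 /= Hx1 Hy1 Hxy1 Hp1.
have [-> ->] // : (x', y') = (x1, y1).
apply: (tableau_inj (v := pw [:: a'; b'])) => //; first by split; rewrite -?Hxy'.
by move/fA_Some: Fxy => [+ _]; rewrite Fx Ew => -[<-].
Qed.
End Insertion.

(** * Invariance of the confluence pair *)

Section Step.
Variable n : nat.
Implicit Types (j p k : nat) (a b c : acol) (w : seq acol).

Definition triple w := size w = 3 /\ all (isACol n) w.

(** Ensures that f_j acts on the same side, the rewritten pair or the third column, before and after
    a step. *)
Lemma ins_stat j a b : j < n -> isACol n a -> isACol n b ->
  let xy := [:: (ins n a b).1; (ins n a b).2] in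
  ep (sgnL n j) (pw xy) = ep (sgnL n j) (pw [:: a; b]) /\
  ph (sgnL n j) (pw xy) = ph (sgnL n j) (pw [:: a; b]).
Proof.
by move=> Hj Ha Hb xy; have [_ _ _ Hp] := insP Ha Hb; split; [exact: plac_ep Hp|exact: plac_ph Hp].
Qed.

Lemma triple_fA j w w' : j < n -> fA n j w = Some w' -> triple w <-> triple w'.
Proof.
move=> Hj E; rewrite /triple (fA_ACol Hj E).
by have /fA_Some [_ /(congr1 size)] := E; rewrite !size_map => ->.
Qed.

Lemma step_triple p w z : triple w -> step_at n p w = Some z -> triple z.
Proof.
case=> S' A'; case: w S' A' => [|a [|b [|c [|]]]] // _ /and4P[Ha Hb Hc _]; case: p => [|[|p]] //=.
  case: ifP => // _ [<-]; have [H1 H2 _ _] := insP Ha Hb.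
  by split; rewrite //= H1 H2 Hc.
case: ifP => // _ [<-]; have [H1 H2 _ _] := insP Hb Hc.
by split; rewrite //= H1 H2 Ha.
Qed.

Lemma step_fA j p w w' : j < n -> triple w -> fA n j w = Some w' ->
  opt_rel (fun z z' => fA n j z = Some z') (step_at n p w) (step_at n p w').
Proof.
move=> Hj Tw E; have [S' A'] := proj1 (triple_fA Hj E) Tw.
case: Tw => S A; case: w S A E => [|a [|b [|c [|]]]] // _ /and4P[Ha Hb Hc _] E.
case: w' S' A' E => [|a' [|b' [|c' [|]]]] // _ /and4P[Ha' Hb' Hc' _] E.
case: p => [|[|p]] //=.
- move: E; rewrite (fA_cat n j [:: a; b] [:: c]).
  have [s1 s2] := ins_stat Hj Ha Hb; case: ifP => Hif.
    case E1: (fA n j [:: a; b]) => [v|] // [Ev].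
    have [x [y [Exy _ _ Haprec]]] := fA_pair Hj Ha Hb E1.
    rewrite Exy in Ev E1; case: Ev => ? ? ?; subst x y c'.
    rewrite -Haprec; case: ifP => // _ /=.
    rewrite (fA_cat n j [:: (ins n a b).1; (ins n a b).2] [:: c]) s2 Hif.
    by rewrite (ins_fA Hj Ha Hb E1).
  case E1: (fA n j [:: c]) => [v|] // [? ? Ev]; subst a' b' v.
  case: ifP => // _ /=.
  by rewrite (fA_cat n j [:: (ins n a b).1; (ins n a b).2] [:: c]) s2 Hif E1.
- move: E; rewrite (fA_cat n j [:: a] [:: b; c]).
  have [s1 s2] := ins_stat Hj Hb Hc; case: ifP => Hif.
    case E1: (fA n j [:: a]) => [v|] // [Ev]; have [x Ex _] := fA1 Hj E1.
    rewrite Ex in Ev E1; case: Ev => ? ? ?; subst x b' c'.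
    case: ifP => // _ /=.
    by rewrite (fA_cat n j [:: a] [:: (ins n b c).1; (ins n b c).2]) s1 Hif E1.
  case E1: (fA n j [:: b; c]) => [v|] // [? Ev]; subst a' v.
  have [x [y [[? ?] _ _ Haprec]]] := fA_pair Hj Hb Hc E1; subst x y.
  rewrite -Haprec; case: ifP => // _ /=.
  rewrite (fA_cat n j [:: a] [:: (ins n b c).1; (ins n b c).2]) s1 Hif.
  by rewrite (ins_fA Hj Hb Hc E1).
Qed.

Lemma altlen_fA j p w w' k : j < n -> triple w -> fA n j w = Some w' ->
  altlen n p w k <-> altlen n p w' k.
Proof.
move=> Hj Tw E; split=> H.
- elim: H w' Tw E => {p w k} [p w Hs|p w z k Hs _ IH] w' Tw E;
    have := step_fA p Hj Tw E; rewrite Hs; case Hs': (step_at n p w') => [z'|] //= Ez.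
    exact: alt_stop.
  by apply: (alt_step Hs'); apply: (IH _ _ Ez); apply: step_triple Hs.
- elim: H w Tw E => {p w' k} [p w' Hs|p w' z' k Hs _ IH] w Tw E;
    have := step_fA p Hj Tw E; rewrite Hs; case Hs': (step_at n p w) => [z|] //= Ez.
    exact: alt_stop.
  by apply: (alt_step Hs'); apply: (IH _ _ Ez); apply: step_triple Hs'.
Qed.

Lemma altlen_connA w w' : connA n w w' ->
  (triple w <-> triple w') /\ (triple w -> forall p k, altlen n p w k <-> altlen n p w' k).
Proof.
elim=> {w w'} [w w' [j Hj E]|w|w w' _ [T H]|w w' w'' _ [T H] _ [T' H']].
- split; first exact: triple_fA E.
  by move=> Tw p k; apply: altlen_fA Tw E.
- by [].
- by split=> [|Tw p k]; [rewrite T|rewrite H // T].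
- by split=> [|Tw p k]; [rewrite T|rewrite H // H' // -T].
Qed.
End Step.

Theorem theorem3p11 (n : nat) (t u v : acol) :
  0 < n -> isACol n t -> isACol n u -> isACol n v ->
  forall w0 : seq acol,
    connA n [:: t; u; v] w0 -> highestA n w0 ->
    forall ka kb, conf_is n [:: t; u; v] ka kb <-> conf_is n w0 ka kb.
Proof.
move=> _ Ht Hu Hv w0 /altlen_connA [_ H] _ ka kb.
by rewrite /conf_is !H //; split; rewrite //= Ht Hu Hv.
Qed.
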